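(* Let $D$ be a bounded domain in $\mathbb{C}^n$ and let $p\in\partial D$ be such that $\partial D$ is $\mathcal{C}^1$ near $p$. There exist a constant $c>0$ and a neighborhood $U$ of $p$ such that for all $q\in D\cap U$, for any choice of a point $p_q\in\partial D$ with $\|q-p_q\|=\delta_D(q)$, and for all $X\in\mathbb{C}^n$, $$c\,S_D(q;X)\ge\frac{\delta^*_D(q)}{\delta_D(q)}\|X_q\|+\|X\|,$$ where $X_q$ is the orthogonal projection of $X$ onto (the direction of) the complex line $L_q$ through $q$ and $p_q$, and $\delta_D^*(q)$ is the directional distance defined (in terms of $p_q$) in the context.
   Context: $\delta_D(q)$ is the Euclidean distance from $q\in D$ to $\partial D$, and $\|\cdot\|$ is the Euclidean norm. For $q\in D$ near $p$ and a chosen point $p_q\in\partial D$ with $\|q-p_q\|=\delta_D(q)$: $L_q$ is the complex line through $q$ and $p_q$ (it contains the real line normal to $\partial D$ at $p_q$); $q^*:=2p_q-q$; $H_{q^*}$ is the complex affine hyperplane through $q^*$ orthogonal to $L_q$; and $$\delta^*_D(q):=\min\bigl(1,\ \operatorname{dist}(q^*,\overline D\cap H_{q^*})\bigr),$$ where $\operatorname{dist}$ is the Euclidean distance from the point to the set, equal to $+\infty$ (so that $\delta_D^*(q)=1$) if $\overline D\cap H_{q^*}=\emptyset$. The Sibony metric is $S_D(z;X):=\sup_v[\mathcal{L}_v(z;X)]^{1/2}$, where $\mathcal{L}_v(z;X)=\sum_{j,k=1}^n\frac{\partial^2 v}{\partial z_j\partial\bar z_k}(z)X_j\overline{X_k}$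 is the Levi form of $v$, and the supremum is over all functions $v:D\to[0,1)$ such that $v(z)=0$, $\log v$ is plurisubharmonic on $D$, and $v$ is of class $\mathcal{C}^2$ near $z$. ''$\partial D$ is $\mathcal{C}^1$ near $p$'' means that, in a neighborhood of $p$ and after a complex-affine unitary change of coordinates, $D$ is the set of points lying strictly on one side of the graph of a real-valued $\mathcal{C}^1$ function of the remaining $2n-1$ real variables. *)

(* Defs.v *)
(* C^n is 'rV[R[i]]_n over an arbitrary R : realType. *)
From HB Require Import structures.
From mathcomp Require Import all_boot all_order all_algebra.
From mathcomp Require Import all_classical all_reals all_analysis.
From mathcomp Require Export spectral.
From mathcomp Require Export complex.

Set Implicit Arguments.
Unset Strict Implicit.
Unset Printing Implicit Defensive.

Import Order.TTheory GRing.Theory Num.Theory.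
Import numFieldNormedType.Exports.

Local Open Scope classical_set_scope.
Local Open Scope ring_scope.
Local Open Scope complex_scope.

(* The topology of R[i] is that of its modulus; 'rV[R[i]]_n gets the product
   topology, which is the Euclidean topology of C^n. *)
HB.instance Definition _ (R : realType) := NormedModule.copy R[i] R[i]^o.

Section Defs.
Context {R : realType} {n : nat}.
Local Notation Cn := 'rV[R[i]]_n.
Implicit Types (z w p q pq X : Cn) (D A : set Cn).

Definition hdot z w : R[i] := \sum_(j < n) z 0 j * (w 0 j)^*.

(* Euclidean, whereas the library norm of 'rV[R[i]]_n is the sup norm *)
Definition enorm z : R := Num.sqrt (complex.Re (hdot z z)).

(* +oo if A is empty *)
Definition eucl_dist z A : \bar R := ereal_inf [set (enorm (z - w))%:E | w in A].

Definition boundary A : set Cn := closure A `\` interior A.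

Definition bounded_domain D : Prop :=
  [/\ open D, connected D, D !=set0 & bounded_set D].

Definition xdir (j : 'I_n) : Cn := delta_mx 0 j.
Definition ydir (j : 'I_n) : Cn := 'i *: delta_mx 0 j.
Definition real_dirs : set Cn := range xdir `|` range ydir.

Definition real_slice (f : Cn -> R) (d z : Cn) (t : R) : R := f (z + t%:C *: d).
Definition partial (d : Cn) (f : Cn -> R) z : R := derive1 (real_slice f d z) 0.

Fixpoint Ck_near (k : nat) (f : Cn -> R) z : Prop :=
  (\forall w \near z, {for w, continuous f}) /\
  if k is k'.+1 then forall d, real_dirs d ->
    (\forall w \near z, derivable (real_slice f d w) 0 1) /\
    Ck_near k' (partial d f) z
  else True.

(* w with Re w_j replaced by 0, i.e. the remaining 2n - 1 real coordinates *)
Definition drop_re (j : 'I_n) w : Cn :=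
  \row_k if k == j then 0 +i* complex.Im (w 0 j) else w 0 k.

(* In unitary affine coordinates w = zA + b, D is near p the strict epigraph
   Re w_j > phi(remaining 2n - 1 real coordinates of w). The other side of a
   graph is covered as well, by changing the sign of w. *)
Definition C1_boundary_near D p : Prop :=
  exists (A : 'M[R[i]]_n) (b : Cn) (j : 'I_n) (phi : Cn -> R),
    [/\ A \is unitarymx,
        Ck_near 1 phi (drop_re j (p *m A + b)) &
        \forall z \near p, D z <->
          phi (drop_re j (z *m A + b)) < complex.Re ((z *m A + b) 0 j)].

(* d^2 v / dz_j dzbar_k, expanded with d/dz_j = (d/dx_j - i d/dy_j) / 2 and
   d/dzbar_k = (d/dx_k + i d/dy_k) / 2 *)
Definition ddbar (v : Cn -> R) z (j k : 'I_n) : R[i] :=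
  (4%:R)^-1 *
  ((partial (xdir j) (partial (xdir k) v) z
    + partial (ydir j) (partial (ydir k) v) z) +i*
   (partial (xdir j) (partial (ydir k) v) z
    - partial (ydir j) (partial (xdir k) v) z)).

Definition Levi (v : Cn -> R) z X : R[i] :=
  \sum_(j < n) \sum_(k < n) ddbar v z j k * X 0 j * (X 0 k)^*.

(* Upper semicontinuity and the sub-mean value inequality on closed complex
   discs contained in D. The function constantly -oo is allowed. *)
Definition plurisubharmonic D (u : Cn -> \bar R) : Prop :=
  [/\ forall z, D z -> (u z < +oo)%E,
      forall z, D z -> forall a : R, (u z < a%:E)%E ->
        \forall w \near z, (u w < a%:E)%E &
      forall z w, (forall x : R[i], `|x| <= 1 -> D (z + x *: w)) ->
        (u z <= ((2 * pi)^-1)%:E *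
          \int[lebesgue_measure]_(t in `[0%R, (2 * pi)%R])
             u (z + (cos t +i* sin t) *: w)%R)%E].

Definition Sibony_class D z (v : Cn -> R) : Prop :=
  [/\ forall w, D w -> 0 <= v w < 1,
      v z = 0,
      plurisubharmonic D (fun w => lne (v w)%:E) &
      Ck_near 2 v z].

(* The Levi form is real (v is C^2 near z), hence the real part. *)
Definition Sibony D z X : \bar R :=
  ereal_sup [set (Num.sqrt (complex.Re (Levi v z X)))%:E | v in Sibony_class D z].

Definition delta D q : R := fine (eucl_dist q (boundary D)).

Definition qstar q pq : Cn := 2%:R *: pq - q.

Definition complex_line q pq : set Cn := [set q + x *: (pq - q) | x in setT].

(* the complex affine hyperplane through z orthogonal to the line L *)
Definition orth_hyperplane z (L : set Cn) : set Cn :=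
  [set w | forall a b, L a -> L b -> hdot (w - z) (a - b) = 0].

Definition delta_star D q pq : R :=
  fine (Order.min 1%E (eucl_dist (qstar q pq)
    (closure D `&` orth_hyperplane (qstar q pq) (complex_line q pq)))).

(* orthogonal projection of X onto the direction C (pq - q) of the line *)
Definition line_proj q pq X : Cn :=
  (hdot X (pq - q) / hdot (pq - q) (pq - q)) *: (pq - q).

End Defs.

(* Main.v *)
Require Import Defs.
From mathcomp Require Import all_boot all_order all_algebra.
From mathcomp Require Import all_classical all_reals all_analysis.
From mathcomp Require Import measurable_realfun ring lra.
Import Order.TTheory GRing.Theory Num.Theory.
Import numFieldNormedType.Exports.
Local Open Scope classical_set_scope.
Local Open Scope complex_scope.
Local Open Scope ring_scope.

(* Let d = delta(q), let nu be the unit normal (pq - q) / d, and let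
   h(z) = <z - q, nu>. Since the boundary is C^1 near p, D has near p an
   exterior cone of aperture close to pi, whose axis is close to nu because the
   ball B(q, d) lies in D. At distance less than delta_star from qstar, the
   points of the orthogonal hyperplane are not in D, which gives
   Re h < 2 d + |Im h|, so that h / (h - 3 d) is bounded on D in a ball of radius
   eps ~ delta_star around q, while its derivative at q is of size 1 / d. Hence
     v_in = eps^2 (|h|^2 + d^2 |z - q|^2) / |h - 3 d|^2
   (up to constants) has the required Levi form at q. It is extended to D by
   taking the maximum with
     v_out = C (|h| / d)^k |z - q|^2,   k = 1 / log(M / d),
   which is larger than v_in where |h| >= d and |z - q| >= eps / 2, smaller near
   q, and bounded on D by a constant independent of d. The term |X| comes from
   the competitor |z - q|^2 / M^2.
   Plurisubharmonicity of log v is checked locally, with four-point means instead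
   of circles; the maximum principle applied to an average of rotations then
   yields the sub-mean value inequality on every disc. *)

(** A competitor must be defined on all of [D], but the sector bound holds only within [delta_star],
    so the local function has to be glued by a maximum. The factor eps^2 makes this possible: at
    distance about eps from q, v_in has at most the size of |z - q|^2, up to constants. The
    resulting Levi form is of order (eps / d)^2, the loss that [delta_star] measures. The power of
    |h| / d in v_out has to be positive, to make v_out negligible near q, but a fixed power would
    reach (M / d)^k on [D], unbounded as d tends to 0. Hence k depends on d and is small, and |h|^k
    decays more slowly than |h|^2. The term d^2 |z - q|^2 in v_in lets it win near q all the same,
    including near the hyperplane h = 0. On a disc, the average of N rotations of a function has the
    same value at the centre, and on the unit circle it is a Riemann sum of the circle mean, with an
    upper bound uniform in the angle. The maximum principle for this average then yields the mean
    value inequality with neither a Poisson integral nor a harmonic majorant. *)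

Notation Re := complex.Re.
Notation Im := complex.Im.
Notation normc := Normc.normc.

(** * Complex numbers and the Hermitian norm *)

Section ComplexFacts.
Context {R : realType}.
Implicit Types x y : R[i].

Lemma cReD x y : Re (x + y) = Re x + Re y. Proof. by case: x; case: y. Qed.
Lemma cImD x y : Im (x + y) = Im x + Im y. Proof. by case: x; case: y. Qed.
Lemma cReN x : Re (- x) = - Re x. Proof. by case: x. Qed.
Lemma cImN x : Im (- x) = - Im x. Proof. by case: x. Qed.
Lemma cReM x y : Re (x * y) = Re x * Re y - Im x * Im y.
Proof. by case: x; case: y. Qed.
Lemma cImM x y : Im (x * y) = Re x * Im y + Im x * Re y.
Proof. by case: x; case: y. Qed.
Lemma cReJ x : Re x^* = Re x. Proof. by case: x. Qed.
Lemma cImJ x : Im x^* = - Im x. Proof. by case: x. Qed.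
Lemma cReZ (r : R) x : Re (r%:C * x) = r * Re x.
Proof. by rewrite cReM /= mul0r subr0. Qed.

Lemma cRe_sum I (s : seq I) (F : I -> R[i]) :
  Re (\sum_(i <- s) F i) = \sum_(i <- s) Re (F i).
Proof. by elim/big_rec2: _ => // i a b _ <-; rewrite cReD. Qed.

Lemma complex_ext x y : Re x = Re y -> Im x = Im y -> x = y.
Proof. by case: x y => [a b] [c d] /= -> ->. Qed.

Lemma normc_ge0 x : 0 <= normc x.
Proof. by case: x => a b; rewrite sqrtr_ge0. Qed.

Lemma normc_sqr x : normc x ^+ 2 = Re x ^+ 2 + Im x ^+ 2.
Proof. by case: x => a b /=; rewrite sqr_sqrtr// addr_ge0// sqr_ge0. Qed.

Lemma mulcJ x : x * x^* = (normc x ^+ 2)%:C.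
Proof.
rewrite normc_sqr; apply: complex_ext; rewrite ?cReM ?cImM cReJ cImJ /=.
  by rewrite mulrN opprK !expr2.
by rewrite mulrN mulrC addNr.
Qed.

Lemma conjD x y : (x + y)^* = x^* + y^*. Proof. exact: rmorphD. Qed.
Lemma conjN x : (- x)^* = - x^*. Proof. exact: rmorphN. Qed.
Lemma conjM x y : (x * y)^* = x^* * y^*. Proof. exact: rmorphM. Qed.

Lemma conjC_realc (r : R) : (r%:C)^* = r%:C.
Proof. by apply: complex_ext; rewrite ?cReJ ?cImJ //= oppr0. Qed.

Lemma normc_real (r : R) : normc r%:C = `|r|.
Proof. by rewrite /= expr0n addr0 sqrtr_sqr. Qed.

Lemma normc_eq0 x : (normc x == 0) = (x == 0).
Proof.
apply/eqP/eqP => [/Normc.eq0_normc//|->]; exact: Normc.normc0.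
Qed.

Lemma normc_gt0 x : (0 < normc x) = (x != 0).
Proof. by rewrite lt_def normc_ge0 normc_eq0 andbT. Qed.

Lemma Re_le_normc x : `|Re x| <= normc x.
Proof.
rewrite -(@ler_pXn2r _ 2)// ?nnegrE ?normc_ge0// normc_sqr real_normK ?num_real//.
by rewrite lerDl sqr_ge0.
Qed.

Lemma Im_le_normc x : `|Im x| <= normc x.
Proof.
rewrite -(@ler_pXn2r _ 2)// ?nnegrE ?normc_ge0// normc_sqr real_normK ?num_real//.
by rewrite lerDr sqr_ge0.
Qed.

Lemma normr_normc x : `|x| = (normc x)%:C. Proof. by []. Qed.

Lemma gt0_complex (e : R[i]) : 0 < e -> exists2 r : R, 0 < r & e = r%:C.
Proof. by case: e => a b; rewrite ltcE /= => /andP[/eqP -> a0]; exists a. Qed.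

End ComplexFacts.

Section Hermitian.
Context {R : realType} {n : nat}.
Local Notation Cn := 'rV[R[i]]_n.
Implicit Types (x y z w : Cn) (a : R[i]).

Lemma hdotDl x y z : hdot (x + y) z = hdot x z + hdot y z.
Proof. by rewrite -big_split; apply: eq_bigr => j _; rewrite mxE mulrDl. Qed.

Lemma hdotZl a x y : hdot (a *: x) y = a * hdot x y.
Proof. by rewrite mulr_sumr; apply: eq_bigr => j _; rewrite mxE mulrA. Qed.

Lemma hdotC x y : hdot y x = (hdot x y)^*.
Proof.
rewrite [RHS]raddf_sum; apply: eq_bigr => j _ /=.
by rewrite conjM conjCK mulrC.
Qed.

Lemma hdotNl x y : hdot (- x) y = - hdot x y.
Proof. by rewrite -scaleN1r hdotZl mulN1r. Qed.

Lemma hdotBl x y z : hdot (x - y) z = hdot x z - hdot y z.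
Proof. by rewrite hdotDl hdotNl. Qed.

Lemma hdotDr x y z : hdot x (y + z) = hdot x y + hdot x z.
Proof. by rewrite hdotC hdotDl conjD -!hdotC. Qed.

Lemma hdotZr a x y : hdot x (a *: y) = a^* * hdot x y.
Proof. by rewrite hdotC hdotZl conjM -hdotC. Qed.

Lemma hdotNr x y : hdot x (- y) = - hdot x y.
Proof. by rewrite hdotC hdotNl conjN -hdotC. Qed.

Lemma hdotBr x y z : hdot x (y - z) = hdot x y - hdot x z.
Proof. by rewrite hdotDr hdotNr. Qed.

Lemma hdot0l x : hdot 0 x = 0.
Proof. by rewrite -(scale0r x) hdotZl mul0r. Qed.

Lemma hdotxx_sum x : hdot x x = (\sum_j normc (x 0 j) ^+ 2)%:C.
Proof.
by rewrite /hdot [RHS]raddf_sum; apply: eq_bigr => j _; rewrite mulcJ.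
Qed.

Lemma enorm_ge0 x : 0 <= enorm x. Proof. exact: sqrtr_ge0. Qed.

Lemma enorm_sqr_sum x : enorm x ^+ 2 = \sum_j normc (x 0 j) ^+ 2.
Proof.
by rewrite /enorm hdotxx_sum sqr_sqrtr//= sumr_ge0// => j _; rewrite sqr_ge0.
Qed.

Lemma hdotxx x : hdot x x = (enorm x ^+ 2)%:C.
Proof. by rewrite enorm_sqr_sum hdotxx_sum. Qed.

Lemma enorm_sqr x : enorm x ^+ 2 = Re (hdot x x).
Proof. by rewrite hdotxx. Qed.

Lemma enormZ a x : enorm (a *: x) = normc a * enorm x.
Proof.
apply/eqP; rewrite -(@eqrXn2 _ 2)// ?enorm_ge0 ?mulr_ge0 ?normc_ge0 ?enorm_ge0//.
rewrite exprMn !enorm_sqr_sum mulr_sumr; apply/eqP/eq_bigr => j _.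
by rewrite mxE Normc.normcM exprMn.
Qed.

Lemma enormN x : enorm (- x) = enorm x.
Proof. by rewrite /enorm hdotNl hdotNr opprK. Qed.

Lemma enormB x y : enorm (x - y) = enorm (y - x).
Proof. by rewrite -opprB enormN. Qed.

Lemma enorm0 : enorm (0 : Cn) = 0.
Proof. by rewrite /enorm hdot0l sqrtr0. Qed.

Lemma normc_le_enorm x j : normc (x 0 j) <= enorm x.
Proof.
rewrite -(@ler_pXn2r _ 2)// ?nnegrE ?normc_ge0 ?enorm_ge0//.
rewrite enorm_sqr_sum (bigD1 j)//= lerDl sumr_ge0// => k _; exact: sqr_ge0.
Qed.

Lemma enorm_eq0 x : (enorm x == 0) = (x == 0).
Proof.
apply/eqP/eqP => [x0|->]; last exact: enorm0.
apply/rowP => j; rewrite mxE; apply/eqP; rewrite -normc_eq0 eq_le normc_ge0 andbT.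
by rewrite -x0 normc_le_enorm.
Qed.

Lemma enorm_gt0 x : (0 < enorm x) = (x != 0).
Proof. by rewrite lt_def enorm_ge0 enorm_eq0 andbT. Qed.

Lemma enormD_sqr x y :
  enorm (x + y) ^+ 2 = enorm x ^+ 2 + 2 * Re (hdot x y) + enorm y ^+ 2.
Proof.
rewrite !enorm_sqr hdotDl !hdotDr !cReD (hdotC x y) cReJ; ring.
Qed.

Lemma hdot_CS x y : normc (hdot x y) <= enorm x * enorm y.
Proof.
have [->|y0] := eqVneq y 0.
  by rewrite -(scale0r 0) hdotZr rmorph0 mul0r scale0r enorm0 mulr0 Normc.normc0.
have yp : 0 < enorm y by rewrite enorm_gt0.
rewrite -(@ler_pXn2r _ 2)// ?nnegrE ?normc_ge0 ?mulr_ge0 ?enorm_ge0//.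
pose c := hdot x y * ((enorm y ^+ 2)^-1)%:C.
have := sqr_ge0 (enorm (x + (- c) *: y)).
rewrite enormD_sqr enormZ exprMn normcN hdotZr.
have -> : (- c)^* * hdot x y = - (normc (hdot x y) ^+ 2 / enorm y ^+ 2)%:C.
  rewrite conjN conjM conjC_realc mulNr; congr (- _).
  by rewrite mulrAC mulrC [_^* * _]mulrC mulcJ mulrC -rmorphM.
rewrite cReN /= Normc.normcM normc_real exprMn.
rewrite (ger0_norm (x := _^-1)) ?invr_ge0 ?sqr_ge0//.
set h := normc _; set ny := enorm y in yp *; set nx := enorm x.
have -> : nx ^+ 2 + 2 * - (h ^+ 2 / ny ^+ 2) + h ^+ 2 * (ny ^+ 2)^-1 ^+ 2 * ny ^+ 2
   = nx ^+ 2 - h ^+ 2 / ny ^+ 2 by field; rewrite gt_eqF.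
by rewrite subr_ge0 ler_pdivrMr ?exprn_gt0// exprMn.
Qed.

Lemma Re_hdot_le x y : `|Re (hdot x y)| <= enorm x * enorm y.
Proof. exact: le_trans (Re_le_normc _) (hdot_CS _ _). Qed.

Lemma enormD x y : enorm (x + y) <= enorm x + enorm y.
Proof.
rewrite -(@ler_pXn2r _ 2)// ?nnegrE ?addr_ge0 ?enorm_ge0// enormD_sqr sqrrD.
rewrite lerD2r lerD2l -[leRHS]mulr_natl ler_pM2l//.
exact: le_trans (ler_norm _) (Re_hdot_le _ _).
Qed.

Lemma enorm_dist x y z : enorm (x - z) <= enorm (x - y) + enorm (y - z).
Proof. by apply: le_trans (enormD _ _); rewrite addrA subrK. Qed.

Lemma enormB_ler x y : `|enorm x - enorm y| <= enorm (x - y).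
Proof.
have h1 := enorm_dist x y 0; have h2 := enorm_dist y x 0.
rewrite !subr0 in h1 h2; rewrite (enormB y) in h2.
by rewrite ler_norml; apply/andP; split; lra.
Qed.

Lemma enorm_le_sum x : enorm x <= \sum_j normc (x 0 j).
Proof.
rewrite {1}(row_sum_delta x); elim/big_rec2: _ => [|j u v _ uv]; first by rewrite enorm0.
apply: le_trans (enormD _ _) _; rewrite lerD// enormZ.
suff -> : enorm (delta_mx 0 j : Cn) = 1 by rewrite mulr1.
rewrite /enorm hdotxx_sum (bigD1 j)//= big1 ?addr0; last first.
  by move=> k kj; rewrite !mxE (negbTE kj) andbF Normc.normc0 expr0n.
by rewrite !mxE !eqxx Normc.normc1 expr1n sqrtr1.
Qed.

End Hermitian.

Section Topology.
Context {R : realType} {n : nat}.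
Local Notation Cn := 'rV[R[i]]_n.
Implicit Types z w : Cn.

Lemma nbhs_normcP (x : R[i]) (P : set R[i]) :
  nbhs x P <-> exists2 r : R, 0 < r & forall y, normc (y - x) < r -> P y.
Proof.
split=> [/nbhs_ballP[e /= /gt0_complex[r r0 ->]] rP|[r r0 rP]].
  exists r => // y yr; apply: rP.
  by rewrite /ball /= normr_normc ltcR -normcN opprB.
apply/nbhs_ballP; exists r%:C => /=; first by rewrite ltcR.
move=> y; rewrite /ball /= normr_normc ltcR -normcN opprB; exact: rP.
Qed.

Lemma nbhs_enormP z (P : set Cn) :
  nbhs z P <-> exists2 r : R, 0 < r & forall w, enorm (w - z) < r -> P w.
Proof.
split=> [/nbhs_ballP[e /= /gt0_complex[r r0 ->]] rP|[r r0 rP]].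
  exists r => // w wr; apply: rP.
  rewrite /ball /=; split=> [|i j]; first by rewrite ltcR.
  rewrite /ball /= normr_normc ltcR ord1.
  apply: le_lt_trans wr; rewrite enormB.
  by apply: le_trans (normc_le_enorm _ j); rewrite !mxE.
(* [enorm] is at most the sum of [n] moduli, each at most [r / n.+1%:R]; the successor makes the
   bound strict and covers [n = 0]. *)
apply/nbhs_ballP; exists (r / n.+1%:R)%:C => /=.
  by rewrite ltcR divr_gt0.
move=> w wr; apply: rP; apply: le_lt_trans (enorm_le_sum _) _.
apply: (@le_lt_trans _ _ (\sum_(j < n) r / n.+1%:R)).
  apply: ler_sum => j _; have := wr.2 0 j.
  by rewrite /ball /= normr_normc ltcR -normcN opprB !mxE => /ltW.
rewrite sumr_const card_ord -[ltLHS]mulr_natr mulrAC ltr_pdivrMr// ltr_pM2l//.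
by rewrite ltr_nat.
Qed.

End Topology.

(** * Sub-mean value inequalities *)

Section PeriodicMean.
Context {R : realType}.
Implicit Types (g : R -> R).
Local Notation mu := (@lebesgue_measure R).

Lemma unif_cont_segment g (a b : R) : continuous g ->
  forall e, 0 < e -> exists2 d, 0 < d &
    forall x y, a <= x <= b -> `|y - x| < d -> `|g y - g x| < e.
Proof.
move=> cg e e0.
have /compact_near_coveringP/near_covering_withinP := @segment_compact _ a b.
move=> /(_ R (0^'+) (fun d x => forall y, `|y - x| < d -> `|g y - g x| < e) _).
case.
  move=> x _; have /cvgrPdist_lt/(_ (e / 2))[|r /= r0 hr] := cg x.
    by rewrite divr_gt0.
  exists (ball x (r / 2), [set d | d < r / 2]) => /=.
    by split; [exact/nbhsx_ballx/divr_gt0|exact/nbhs_right_lt/divr_gt0].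
  move=> [x' d] /= [xx' dr] _ y yx'.
  have h1 : `|g x - g x'| < e / 2.
    by apply: hr; apply: lt_le_trans xx' _; lra.
  have h2 : `|g x - g y| < e / 2.
    apply: hr; rewrite /ball_ /= (_ : x - y = (x - x') - (y - x')); last by ring.
    apply: le_lt_trans (ler_normB _ _) _.
    by rewrite (splitr r) ltrD// (lt_trans yx').
  rewrite (_ : g y - g x' = (g x - g x') - (g x - g y)); last by ring.
  by apply: le_lt_trans (ler_normB _ _) _; rewrite (splitr e) ltrD.
move=> d /= d0 hd; exists (d / 2); first exact: divr_gt0.
move=> x y xab yx; apply: (hd (d / 2)) => //=.
- rewrite sub0r normrN gtr0_norm ?divr_gt0// ltr_pdivrMr// ltr_pMr// ltr1n//.
- exact: divr_gt0.
Qed.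

Lemma continuous_primitive g (a b : R) : continuous g -> exists G : R -> R,
  forall x, a < x < b -> derivable G x 1 /\ derive1 G x = g x.
Proof.
move=> cg; exists (fun x => \int[mu]_(t in [set` `[a, x]]) g t) => x /andP[ax xb].
apply: (continuous_FTC1_closed xb) => //; last exact: cg.
apply: continuous_compact_integrable; first exact: segment_compact.
exact: continuous_subspaceT.
Qed.

(* Riemann sums over the orbit of a rotation: for a primitive [G] of [g], both
   the integral over a period and the sum are increments of [G], compared step
   by step with the mean value theorem. *)
Lemma periodic_riemann g (T : R) : continuous g -> 0 < T ->
  (forall t, g (t + T) = g t) -> forall e, 0 < e ->
  exists N : nat, forall s, 0 <= s <= T ->
    N.+1%:R^-1 * \sum_(k < N.+1) g (s + k%:R * (T / N.+1%:R))
      <= T^-1 * \int[mu]_(t in `[0, T]) g t + e.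
Proof.
move=> cg T0 gT e e0.
(* The open interval contains [[0, 2T]], hence all sample points [s + k h] and their successors, and
   the end points cause no trouble. *)
have [G dG] := @continuous_primitive g (- T) (T * 3) cg.
have dG' x : - T < x < T * 3 -> is_derive x 1 G (g x).
  by move=> /dG[dGx <-]; rewrite derive1E; exact: derivableP.
have cG x : - T < x < T * 3 -> {for x, continuous G}.
  move=> /dG[dGx _]; apply/differentiable_continuous/derivable1_diffP => //.
have mvtG x y : - T < x -> x < y -> y < T * 3 ->
    exists2 c, x < c < y & G y - G x = g c * (y - x).
  move=> Tx xy yT; have [||c] := @MVT _ G g x y xy.
  - move=> z; rewrite in_itv/= => /andP[xz zy]; apply: dG'.
    by rewrite (lt_trans Tx)// (lt_trans zy).
  - apply: continuous_in_subspaceT => z; rewrite inE /= in_itv/= => /andP[xz zy].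
    by apply: cG; rewrite (lt_le_trans Tx)// (le_lt_trans zy).
  - by rewrite in_itv/= => h1 h2; exists c.
have intG : \int[mu]_(t in `[0, T]) g t = G T - G 0.
  rewrite /Rintegral (@continuous_FTC2 _ g G 0 T)//.
  - exact: continuous_subspaceT.
  - split.
    + move=> x; rewrite in_itv/= => /andP[x0 xT].
      by have [] := dG x; [apply/andP; split; nra|].
    + apply: cvg_at_right_filter; apply: cG; apply/andP; split; nra.
    + apply: cvg_at_left_filter; apply: cG; apply/andP; split; nra.
  - move=> x; rewrite in_itv/= => /andP[x0 xT].
    by have [] := dG x; [apply/andP; split; nra|].
have GT s : 0 <= s <= T -> G (s + T) - G s = G T - G 0.
  move=> /andP[]; rewrite le_eqVlt => /predU1P[<- _|s0 sT]; first by rewrite add0r.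
  (* By periodicity [H] has derivative zero, so the increment of [G] over one period does not depend
     on the starting point. *)
  pose H t := G (t + T) - G t.
  have dH x : - T < x < T * 2 -> is_derive x 1 H 0.
    move=> /andP[x1 x2].
    have h1 : is_derive (x + T) 1 G (g (x + T)) by apply: dG'; apply/andP; split; nra.
    have h2 : is_derive x 1 G (g x) by apply: dG'; apply/andP; split; nra.
    have h3 : is_derive x 1 (fun t => t + T) 1.
      by have := is_deriveD (is_derive_id x 1) (is_derive_cst T x 1); rewrite addr0.
    have h4 := is_derive1_comp (f := G) (g := fun t => t + T) h1 h3.
    have := is_deriveB h4 h2.
    by rewrite gT mulr1 subrr.
  have [||c _] := @MVT _ H (fun=> 0) 0 s s0.
  - move=> x; rewrite in_itv/= => /andP[x0 xs]; apply: dH; apply/andP; split; nra.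
  - apply: continuous_in_subspaceT => x; rewrite inE /= in_itv/= => /andP[x0 xs].
    apply/differentiable_continuous/derivable1_diffP.
    by have [] := dH x; [apply/andP; split; nra|].
  - by rewrite mul0r => /eqP; rewrite subr_eq0 /H add0r => /eqP.
have [d d0 hd] := @unif_cont_segment g 0 (T * 2) cg e e0.
have [N hN] : exists N : nat, T / N.+1%:R < d.
  exists (Num.truncn (T / d)); rewrite ltr_pdivrMr// mulrC -ltr_pdivrMr//.
  exact/real_truncnS_gt/num_real.
exists N => s s0T; rewrite intG -(GT _ s0T).
set h := T / N.+1%:R in hN *.
have h0 : 0 < h by rewrite divr_gt0.
have Nh : N.+1%:R * h = T by rewrite mulrC divfK// pnatr_eq0.
case/andP: s0T => s0 sT.
have step (k : 'I_N.+1) : h * (g (s + k%:R * h) - e) <=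
    G (s + k.+1%:R * h) - G (s + k%:R * h).
  have k0 : 0 <= k%:R * h by rewrite mulr_ge0// ltW.
  have kN : k.+1%:R * h <= T by rewrite -Nh ler_pM2r// ler_nat.
  have kS : k.+1%:R * h = k%:R * h + h by rewrite -natr1; ring.
  have [| | |c /andP[c1 c2] ->] := mvtG (s + k%:R * h) (s + k.+1%:R * h); try lra.
  rewrite (_ : _ - (s + _) = h); last by lra.
  rewrite [leRHS]mulrC ler_pM2l//.
  have : `|g c - g (s + k%:R * h)| < e.
    by apply: hd; [apply/andP; split; lra|rewrite ltr_norml; apply/andP; split; lra].
  by rewrite ltr_norml => /andP[H _]; lra.
have : h * \sum_(k < N.+1) g (s + k%:R * h) - T * e <= G (s + T) - G s.
  have -> : G (s + T) - G s = \sum_(k < N.+1) (G (s + k.+1%:R * h) - G (s + k%:R * h)).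
    rewrite -(big_mkord xpredT (fun k => G (s + k.+1%:R * h) - G (s + k%:R * h))).
    by rewrite telescope_sumr// Nh mul0r addr0.
  apply: le_trans (ler_sum _ (fun k _ => step k)).
  rewrite -mulr_sumr sumrB sumr_const card_ord -[e *+ _]mulr_natr -Nh.
  rewrite mulrBr lerD2l lerN2 (_ : h * (e * N.+1%:R) = N.+1%:R * h * e)//.
  by rewrite mulrCA mulrC [RHS]mulrAC [RHS]mulrC mulrA.
move=> H.
rewrite -(ler_pM2l T0) mulrDr (mulrA T T^-1) mulfV ?gt_eqF// mul1r.
rewrite (mulrA T N.+1%:R^-1) -/h.
by rewrite -lerBlDr.
Qed.

End PeriodicMean.

(** * Maximum principle and mean value inequality on the unit disc *)

Section Circle.
Context {R : realType}.
Implicit Types (x y : R[i]) (u : R[i] -> R) (t : R).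

Definition cis t : R[i] := cos t +i* sin t.

Lemma cisD s t : cis (s + t) = cis s * cis t.
Proof. by apply: complex_ext; rewrite ?cReM ?cImM /= ?cosD ?sinD// addrC. Qed.

Lemma normc_cis t : normc (cis t) = 1.
Proof. by rewrite /= cos2Dsin2 sqrtr1. Qed.

Lemma cis_periodic t : cis (t + 2 * pi) = cis t.
Proof. by rewrite /cis mulr_natl cosD2pi sinD2pi. Qed.

Lemma polar x : exists2 t, 0 <= t <= 2 * pi & x = (normc x)%:C * cis t.
Proof.
have p0 := pi_gt0 R.
have [->|x0] := eqVneq x 0.
  by exists 0; [apply/andP; split; lra|rewrite Normc.normc0 mul0r].
have nx : 0 < normc x by rewrite normc_gt0.
have := normc_sqr x; set r := normc x in nx *; set a := Re x; set b := Im x => E.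
have ar : -1 <= a / r <= 1.
  rewrite -ler_norml normrM normrV ?unitfE ?gt_eqF// (gtr0_norm nx).
  by rewrite ler_pdivrMr// mul1r Re_le_normc.
have sb : Num.sqrt (1 - (a / r) ^+ 2) = `|b| / r.
  have -> : 1 - (a / r) ^+ 2 = (`|b| / r) ^+ 2.
    rewrite !exprMn real_normK ?num_real//.
    have -> : b ^+ 2 = r ^+ 2 - a ^+ 2 by rewrite E; ring.
    by field; rewrite gt_eqF.
  by rewrite sqrtr_sqr ger0_norm// divr_ge0// ltW.
have c1 := acos_ge0 ar; have c2 := acos_lepi ar.
have [b0|b0] := leP 0 b.
  exists (acos (a / r)); first by apply/andP; split; lra.
  apply: complex_ext; rewrite ?cReM ?cImM /= !mul0r ?subr0 ?addr0.
    by rewrite acosK ?in_itv// mulrC divfK ?gt_eqF.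
  by rewrite sin_acos// sb ger0_norm// mulrC divfK ?gt_eqF.
exists (2 * pi - acos (a / r)); first by apply/andP; split; lra.
have -> : cis (2 * pi - acos (a / r)) = cis (- acos (a / r)).
  by rewrite addrC cis_periodic.
apply: complex_ext; rewrite ?cReM ?cImM /= !mul0r ?subr0 ?addr0.
  by rewrite cosN acosK ?in_itv// mulrC divfK ?gt_eqF.
by rewrite sinN sin_acos// sb ltr0_norm// -/b; field; rewrite gt_eqF.
Qed.

Lemma continuous_complex (T : topologicalType) (a b : T -> R) (t : T) :
  {for t, continuous a} -> {for t, continuous b} ->
  {for t, continuous (fun s => a s +i* b s)}.
Proof.
move=> /cvgrPdist_lt ca /cvgrPdist_lt cb P /nbhs_normcP[e e0 he].
have e20 : 0 < e / 2 by rewrite divr_gt0.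
change (\forall s \near t, P (a s +i* b s)); near=> s; apply: he.
have h1 : `|a t - a s| < e / 2 by near: s; exact: ca.
have h2 : `|b t - b s| < e / 2 by near: s; exact: cb.
have -> : a s +i* b s - (a t +i* b t) = (a s - a t)%:C + 'i%C * (b s - b t)%:C.
  by apply: complex_ext; rewrite ?cReD ?cImD ?cReM ?cImM /=; ring.
apply: le_lt_trans (le_normcD _ _) _.
rewrite Normc.normcM !normc_real /= expr0n expr1n add0r sqrtr1 mul1r.
by rewrite (splitr e) ltrD// distrC.
Unshelve. all: by end_near. Qed.

Lemma continuous_cis : continuous cis.
Proof.
by move=> t; apply: continuous_complex; [exact: continuous_cos|exact: continuous_sin].
Qed.

Lemma lipschitz_normc_continuous (f : R[i] -> R[i]) x (K : R) :
  (forall y, normc (f y - f x) <= K * normc (y - x)) -> {for x, continuous f}.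
Proof.
move=> fK P /nbhs_normcP[e e0 he]; apply/nbhs_normcP.
have K0 : 0 < `|K| + 1 by rewrite ltr_wpDl.
exists (e / (`|K| + 1)); first by rewrite divr_gt0.
move=> y; rewrite ltr_pdivlMr// => yx; apply: he.
apply: le_lt_trans (fK y) _; apply: le_lt_trans yx.
rewrite mulrC ler_wpM2l ?normc_ge0//.
by apply: le_trans (ler_norm _) _; rewrite lerDl.
Qed.

Lemma continuous_mulcl (c x : R[i]) : {for x, continuous (fun y => y * c)}.
Proof.
apply: (@lipschitz_normc_continuous _ _ (normc c)) => y.
by rewrite -mulrBl Normc.normcM mulrC.
Qed.

Local Notation I := (0 +i* 1 : R[i]).

Lemma normc_I : normc I = 1 :> R.
Proof. by rewrite /= expr0n expr1n add0r sqrtr1. Qed.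

(* A harmonic function equals its mean over the vertices of a small square up to
   [o(|y|^2)]; unlike the sub-mean value property over circles, this property is
   visibly local and needs no integration. *)
Definition locally_submean u x := forall e, 0 < e -> exists2 r, 0 < r &
  forall y, normc y < r ->
    4 * u x <= u (x + y) + u (x - y) + u (x + I * y) + u (x - I * y)
               + e * normc y ^+ 2.

Lemma locally_submean_cst (c : R) x : locally_submean (fun=> c) x.
Proof.
move=> e e0; exists 1 => // y _.
have := mulr_ge0 (ltW e0) (sqr_ge0 (normc y)); lra.
Qed.

Lemma locally_submeanD u v x : locally_submean u x -> locally_submean v x ->
  locally_submean (fun y => u y + v y) x.
Proof.
move=> hu hv e e0; have e20 : 0 < e / 2 by rewrite divr_gt0.
have [r r0 hr] := hu _ e20; have [s s0 hs] := hv _ e20.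
exists (Num.min r s); first by rewrite lt_min r0 s0.
by move=> y; rewrite lt_min => /andP[/hr h1 /hs h2]; lra.
Qed.

Lemma locally_submeanZ (c : R) u x : 0 <= c -> locally_submean u x ->
  locally_submean (fun y => c * u y) x.
Proof.
move=> c0 hu e e0; have c1 : 0 < c + 1 by lra.
have [r r0 hr] := hu (e / (c + 1)) (divr_gt0 e0 c1).
exists r => // y /hr h; have := ler_wpM2l c0 h.
have : c * (e / (c + 1) * normc y ^+ 2) <= e * normc y ^+ 2.
  rewrite mulrA ler_wpM2r ?sqr_ge0// mulrCA ger_pMr//.
  by rewrite ler_pdivrMr// mul1r; lra.
lra.
Qed.

Lemma locally_submean_sum (J : Type) (s : seq J) (F : J -> R[i] -> R) x :
  (forall j, locally_submean (F j) x) ->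
  locally_submean (fun y => \sum_(j <- s) F j y) x.
Proof.
move=> hF; elim: s => [|j s IH].
  have -> : (fun y => \sum_(j <- [::]) F j y) = fun=> 0.
    by apply/funext => y; rewrite big_nil.
  exact: locally_submean_cst.
have -> : (fun y => \sum_(k <- j :: s) F k y) =
    (fun y => F j y + \sum_(k <- s) F k y).
  by apply/funext => y; rewrite big_cons.
exact: locally_submeanD.
Qed.

Lemma locally_submean_rot (c x : R[i]) u : normc c = 1 ->
  locally_submean u (x * c) -> locally_submean (fun y => u (y * c)) x.
Proof.
move=> c1 hu e e0; have [r r0 hr] := hu e e0; exists r => // y yr.
have := hr (y * c); rewrite Normc.normcM c1 mulr1 => /(_ yr).
by rewrite mulrA -!mulrDl -!mulrBl.
Qed.

(** Only [u x] stands on the smaller side of the inequality, so a minorant touching [u] at [x] may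
    replace [u]. Maxima are treated this way, the minorant being the active branch. *)
Lemma locally_submean_support u v x : v x = u x ->
  (exists2 r, 0 < r & forall y, normc (y - x) < r -> v y <= u y) ->
  locally_submean v x -> locally_submean u x.
Proof.
move=> vu [r r0 hr] hv e e0; have [s s0 hs] := hv e e0.
exists (Num.min r s); first by rewrite lt_min r0 s0.
move=> y; rewrite lt_min => /andP[yr /hs]; rewrite vu => h.
have := hr (x + y); rewrite addrC addKr => /(_ yr).
have := hr (x - y); rewrite addrC addKr normcN => /(_ yr).
have := hr (x + I * y); rewrite addrC addKr Normc.normcM normc_I mul1r => /(_ yr).
have := hr (x - I * y); rewrite addrC addKr normcN Normc.normcM normc_I mul1r.
by move=> /(_ yr); lra.
Qed.

(** The excess [4 * normc y ^+ 2] is what makes [u + e * normc x ^+ 2] strictly submean: it beats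
    the error [e * normc y ^+ 2] allowed by [locally_submean]. *)
Lemma normc_square_mean x y :
  normc (x + y) ^+ 2 + normc (x - y) ^+ 2 + normc (x + I * y) ^+ 2
    + normc (x - I * y) ^+ 2 = 4 * normc x ^+ 2 + 4 * normc y ^+ 2.
Proof.
case: x y => [a b] [c d]; rewrite !normc_sqr /=; ring.
Qed.

Section DiscMean.
Variable u : R[i] -> R.
Hypothesis cu : forall x, normc x <= 1 -> {for x, continuous u}.
Hypothesis lu : forall x, normc x < 1 -> locally_submean u x.

Let T : R := 2 * pi.
Let U (N : nat) x := N.+1%:R^-1 * \sum_(k < N.+1) u (x * cis (k%:R * (T / N.+1%:R))).

Let polar_map (p : R * R) : R[i] := (p.1 * cos p.2) +i* (p.1 * sin p.2).

Let polar_mapE p : polar_map p = p.1%:C * cis p.2.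
Proof.
by apply: complex_ext; rewrite ?cReM ?cImM /= !mul0r ?subr0 ?addr0.
Qed.

Let continuous_polar_map : continuous polar_map.
Proof.
have c1 : continuous (fst : R * R -> R) by move=> q; exact: cvg_fst.
have c2 (f : R -> R) : continuous f -> continuous (fun q : R * R => f q.2).
  by move=> cf q; apply: (continuous_comp (f := snd)); [exact: cvg_snd|exact: cf].
move=> p; have := continuous_complex (R * R)%type (fun p => p.1 * cos p.2)
  (fun p => p.1 * sin p.2) p; apply.
- exact: (continuousM (c1 p) (c2 _ (@continuous_cos R) p)).
- exact: (continuousM (c1 p) (c2 _ (@continuous_sin R) p)).
Qed.

(** Maximum principle for [h]: since [U N] is locally submean, the term in [e] forbids a maximum
    inside the disc. At the centre [h] equals [u 0], and on the circle it is [U N] plus [e]. *)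
Let U_max (N : nat) (e : R) : 0 < e ->
  exists2 t, 0 <= t <= T & u 0 <= U N (cis t) + e.
Proof.
move=> e0; pose h x := U N x + e * normc x ^+ 2.
have T0 : 0 < T by rewrite mulr_gt0// pi_gt0.
(* In polar coordinates the closed disc is the image of a compact rectangle, on which the maximum is
   taken. *)
pose A := `[(0:R), 1] `*` `[0, T].
have ch : {within A, continuous (h \o polar_map)}.
  apply: continuous_in_subspaceT => p; rewrite inE => -[/=].
  rewrite !in_itv /= => /andP[p0 p1] _.
  have px : normc (polar_map p) <= 1.
    by rewrite polar_mapE Normc.normcM normc_cis mulr1 normc_real ger0_norm.
  have -> : h \o polar_map = fun p => U N (polar_map p) + e * p.1 ^+ 2.
    apply/funext => q /=; rewrite /h polar_mapE Normc.normcM normc_cis mulr1.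
    by rewrite normc_real real_normK// num_real.
  have cB : {for p, continuous (fun p : R * R => e * p.1 ^+ 2)}.
    have f1 : {for p, continuous (fst : R * R -> R)} by exact: cvg_fst.
    have ce : {for p, continuous (fun=> e : R)} by exact: cst_continuous.
    exact: (continuousM ce (continuousM f1 f1)).
  suff cU : {for p, continuous (fun p => U N (polar_map p))} by exact: continuousD cU cB.
  have cN : {for p, continuous (fun=> N.+1%:R^-1 : R)} by exact: cst_continuous.
  have cS (s : seq 'I_N.+1) : {for p, continuous (fun p =>
      \sum_(k <- s) u (polar_map p * cis (k%:R * (T / N.+1%:R))))}.
    elim: s => [|i s IH].
      have -> : (fun p => \sum_(k <- [::])
          u (polar_map p * cis ((k : 'I_N.+1)%:R * (T / N.+1%:R))))
         = fun=> 0 by apply/funext => q; rewrite big_nil.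
      exact: cst_continuous.
    have -> : (fun p => \sum_(k <- i :: s) u (polar_map p * cis (k%:R * (T / N.+1%:R))))
      = (fun p => u (polar_map p * cis (i%:R * (T / N.+1%:R))))
        \+ (fun p => \sum_(k <- s) u (polar_map p * cis (k%:R * (T / N.+1%:R)))).
      by apply/funext => q; rewrite big_cons.
    have h1 : {for p, continuous polar_map} by exact: continuous_polar_map.
    have h2 : {for polar_map p, continuous (fun x => x * cis (i%:R * (T / N.+1%:R)))}.
      exact: continuous_mulcl.
    have h3 : {for polar_map p * cis (i%:R * (T / N.+1%:R)), continuous u}.
      by apply: cu; rewrite Normc.normcM normc_cis mulr1.
    exact: (continuousD (continuous_comp h1 (continuous_comp h2 h3)) IH).
  exact: (continuousM cN (cS _)).
have A0 : A !=set0 by exists (0, 0); split; rewrite /= in_itv/= ?lexx ?ler01 ?ltW.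
have cA : compact A by apply: compact_setX; exact: segment_compact.
have [[r t] /set_mem[/=]] := compact_EVT_max A0 cA ch.
rewrite !in_itv/= => /andP[r0 r1] t0T hmax.
have hmax' x : normc x <= 1 -> h x <= h (polar_map (r, t)).
  move=> x1; have [s s0T {1}->] := polar x.
  rewrite -(polar_mapE (normc x, s)); apply: hmax; rewrite inE; split => /=.
    by rewrite in_itv /= normc_ge0.
  by rewrite in_itv.
set x0 := polar_map (r, t) in hmax'.
have nx0 : normc x0 = r.
  by rewrite /x0 polar_mapE Normc.normcM normc_cis mulr1 normc_real ger0_norm.
have [r1'|r1'] := ltP r 1; last first.
  exists t => //; have := hmax' 0; rewrite Normc.normc0 => /(_ ler01).
  have -> : x0 = cis t by rewrite /x0 polar_mapE (@le_anti _ _ r 1) ?r1// mul1r.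
  rewrite /h Normc.normc0 normc_cis expr0n mulr0 addr0 expr1n mulr1.
  congr (_ <= _); rewrite /U; under eq_bigr do rewrite mul0r.
  by rewrite sumr_const card_ord -(mulr_natl (u 0)) mulKf ?pnatr_eq0.
have lU : locally_submean (U N) x0.
  apply: locally_submeanZ; first by rewrite invr_ge0.
  apply: locally_submean_sum => k; apply: locally_submean_rot.
    exact: normc_cis.
  by apply: lu; rewrite Normc.normcM normc_cis mulr1 nx0.
have [s s0 hs] := lU e e0.
pose q := Num.min (s / 2) (1 - r).
have q0 : 0 < q by rewrite lt_min divr_gt0//= subr_gt0.
have qs : q < s by rewrite gt_min; apply/orP; left; lra.
have qr : q <= 1 - r by rewrite ge_min lexx orbT.
have nq : normc q%:C = q by rewrite normc_real gtr0_norm.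
have near y : normc y = q -> h (x0 + y) <= h x0.
  move=> yq; apply: hmax'; apply: le_trans (le_normcD _ _) _.
  by rewrite nx0 yq; lra.
(* Adding up the four vertices gives [4 * h x0 + 3 * e * q ^+ 2 <= 4 * h x0], a contradiction. *)
have := near q%:C nq; have := near (- q%:C); rewrite normcN => /(_ nq).
have := near (I * q%:C); rewrite Normc.normcM normc_I mul1r => /(_ nq).
have := near (- (I * q%:C)); rewrite normcN Normc.normcM normc_I mul1r => /(_ nq).
have := hs q%:C; rewrite nq => /(_ qs).
have := normc_square_mean x0 q%:C; rewrite nq /h => E.
have := mulr_gt0 e0 (exprn_gt0 2 q0).
have := congr1 (fun z => e * z) E; rewrite !mulrDr; lra.
Qed.

Lemma disc_mean :
  u 0 <= (2 * pi)^-1 * \int[lebesgue_measure]_(t in `[0, 2 * pi]) u (cis t).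
Proof.
have T0 : 0 < T by rewrite mulr_gt0// pi_gt0.
apply/ler_addgt0Pr => e e0; have e20 : 0 < e / 2 by rewrite divr_gt0.
have [|t|N hN] := @periodic_riemann _ (u \o cis) T _ T0 _ _ e20.
- move=> t; apply: continuous_comp; first exact: continuous_cis.
  by apply: cu; rewrite normc_cis.
- by rewrite /= cis_periodic.
have [t t0T ut] := @U_max N _ e20.
apply: le_trans ut _; have := hN t t0T; rewrite /U.
under eq_bigr do rewrite /= cisD.
by rewrite -/T /= => H; rewrite [leRHS]addrC {2}(splitr e) -addrA addrC lerD2r addrC.
Qed.

End DiscMean.
End Circle.

(** * Logarithms of moduli and of Hermitian norms *)

Section LogSubmean.
Context {R : realType}.
Implicit Types (a b x y : R[i]).
Local Notation I := (0 +i* 1 : R[i]).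

(** The four logarithms add up to that of the modulus of [a ^+ 4 - b ^+ 4], so their sum differs
    from four times the central value by a term of order four in [b]. *)
Lemma normc_square_prod a b :
  normc (a + b) * normc (a - b) * normc (a + I * b) * normc (a - I * b)
  = normc (a ^+ 4 - b ^+ 4).
Proof.
rewrite -!Normc.normcM; congr normc.
have I2 : I * I = -1 by apply: complex_ext; rewrite ?cReM ?cImM /=; ring.
transitivity ((a ^+ 2 - b ^+ 2) * (a ^+ 2 - (I * I) * b ^+ 2)); first by ring.
by rewrite I2; ring.
Qed.

Lemma normcX x n : normc (x ^+ n) = normc x ^+ n.
Proof.
elim: n => [|n IH]; first by rewrite !expr0 Normc.normc1.
by rewrite !exprS Normc.normcM IH.
Qed.

Lemma ln_ge_N2 (t : R) : 0 <= t <= 2^-1 -> - (2 * t) <= ln (1 - t).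
Proof.
move=> /andP[t0 t1]; have p : 0 < 1 - t by lra.
have := @le_ln1Dx _ (t / (1 - t)) (lt_le_trans (ltrN10 _) (divr_ge0 t0 (ltW p))).
have -> : 1 + t / (1 - t) = (1 - t)^-1 by field; rewrite gt_eqF.
rewrite lnV ?posrE// => h.
suff : t / (1 - t) <= 2 * t by lra.
by rewrite ler_pdivrMr//; nra.
Qed.

(** The logarithm of the modulus of a nonvanishing affine function is harmonic. The two-sided
    estimate serves both the positive logarithms and the negative one coming from the pole of the
    local competitor. *)
Lemma ln_square_near a b : a != 0 -> forall e, 0 < e -> exists2 r : R, 0 < r &
  forall y, normc y < r ->
   `| ln (normc (a + b * y) ^+ 2) + ln (normc (a - b * y) ^+ 2)
    + ln (normc (a + b * (I * y)) ^+ 2) + ln (normc (a - b * (I * y)) ^+ 2)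
    - 4 * ln (normc a ^+ 2) | <= e * normc y ^+ 2.
Proof.
rewrite -normc_gt0; set A := normc a => a0 e e0.
pose K := normc b / A; have K0 : 0 <= K by rewrite divr_ge0 ?normc_ge0 ?ltW.
have K4 : 0 < 4 * K ^+ 4 + 1 by have := exprn_ge0 4 K0; lra.
have K1 : 0 < 2 * (K + 1) by lra.
(* The second bound gives [K * s <= 2^-1], which keeps all four points away from the zero; the first
   and third give [4 * (K * s) ^+ 4 <= e * s ^+ 2]. *)
exists (Num.min (Num.min 1 (2 * (K + 1))^-1) (e / (4 * K ^+ 4 + 1))).
  by rewrite !lt_min ltr01 invr_gt0 K1 divr_gt0.
move=> y; rewrite !lt_min => /andP[/andP[y1 yK] ye].
move: y1 yK ye; set s := normc y => y1 yK ye; have s0 : 0 <= s by exact: normc_ge0.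
have Ks : K * s <= 2^-1.
  have : s * (2 * (K + 1)) < 1.
    by rewrite -ltr_pdivlMr ?div1r// mulr_gt0 ?ltr_wpDl.
  by nra.
have bs : normc (b * y) = A * (K * s).
  by rewrite Normc.normcM mulrA mulrC [A * K]mulrC divfK ?gt_eqF// mulrC.
have nz (c : R[i]) : normc c = normc (b * y) -> 0 < normc (a + c).
  move=> cb; have := le_normcD (a + c) (- c); rewrite addrK normcN cb bs -/A.
  by nra.
have nzN (c : R[i]) : normc c = normc (b * y) -> 0 < normc (a - c).
  by move=> cb; apply: nz; rewrite normcN.
have bI : normc (I * (b * y)) = normc (b * y).
  by rewrite [LHS]Normc.normcM normc_I mul1r.
rewrite !(mulrCA b).
have p1 := nz _ (erefl _); have p2 := nzN _ (erefl _).
have p3 := nz _ bI; have p4 := nzN _ bI.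
rewrite !lnXn//.
have -> : ln (normc (a + b * y)) *+ 2 + ln (normc (a - b * y)) *+ 2
    + ln (normc (a + I * (b * y))) *+ 2 + ln (normc (a - I * (b * y))) *+ 2
   = 2 * ln (normc (a ^+ 4 - (b * y) ^+ 4)).
  rewrite -normc_square_prod !lnM ?posrE ?mulr_gt0//.
  by ring.
set t := (K * s) ^+ 4.
have t0 : 0 <= t by rewrite exprn_ge0// mulr_ge0.
have t1 : t <= 2^-1.
  have u0 := mulr_ge0 K0 s0; have u2 : (K * s) ^+ 2 <= 2^-1 by rewrite expr2; nra.
  rewrite /t (exprM _ 2 2); move: (sqr_ge0 (K * s)) u2.
  by set w := _ ^+ 2 => w0 w1; rewrite expr2; nra.
have nb4 : normc ((b * y) ^+ 4) = A ^+ 4 * t by rewrite normcX bs exprMn.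
have A4 : 0 < A ^+ 4 by rewrite exprn_gt0.
have up : normc (a ^+ 4 - (b * y) ^+ 4) <= A ^+ 4 * (1 + t).
  apply: le_trans (le_normcD _ _) _.
  by rewrite normcN nb4 normcX mulrDr mulr1.
have lo : A ^+ 4 * (1 - t) <= normc (a ^+ 4 - (b * y) ^+ 4).
  have := le_normcD (a ^+ 4 - (b * y) ^+ 4) ((b * y) ^+ 4).
  by rewrite subrK nb4 normcX mulrBr mulr1 -/A; lra.
have t1' : 0 < 1 - t by lra.
have P0 : 0 < normc (a ^+ 4 - (b * y) ^+ 4).
  by apply: lt_le_trans lo; rewrite mulr_gt0.
have lnA (w : R) : 0 < w -> ln (A ^+ 4 * w) = 4 * ln A + ln w.
  by move=> w0; rewrite lnM ?posrE// lnXn// [in RHS]mulr_natl.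
have t1p : 0 < 1 + t by lra.
have h1 : ln (normc (a ^+ 4 - (b * y) ^+ 4)) <= 4 * ln A + ln (1 + t).
  by rewrite -lnA// ler_ln ?posrE ?mulr_gt0.
have h2 : 4 * ln A + ln (1 - t) <= ln (normc (a ^+ 4 - (b * y) ^+ 4)).
  by rewrite -lnA// ler_ln ?posrE ?mulr_gt0.
move: h1 h2.
have : ln (1 + t) <= t by apply: le_ln1Dx; lra.
have : - (2 * t) <= ln (1 - t) by apply: ln_ge_N2; rewrite t0.
have : 4 * t <= e * s ^+ 2.
  have -> : t = K ^+ 4 * s ^+ 2 * s ^+ 2 by rewrite /t; ring.
  rewrite mulrA ler_wpM2r ?exprn_ge0//.
  have : s * (4 * K ^+ 4 + 1) <= e by rewrite -ler_pdivlMr// ltW.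
  have : K ^+ 4 * s ^+ 2 <= K ^+ 4 * s.
    by rewrite ler_wpM2l ?exprn_ge0// expr2; nra.
  by have := mulr_ge0 s0 (exprn_ge0 4 K0); nra.
rewrite -(mulr_natl (ln A)) ler_norml => h1 h2 h3 h4 h5; apply/andP; split; lra.
Qed.

Lemma locally_submean_ln_normc a b : a != 0 ->
  locally_submean (fun y => ln (normc (a + b * y) ^+ 2)) 0.
Proof.
move=> a0 e e0; have [r r0 hr] := ln_square_near a b a0 e e0.
exists r => // y /hr; rewrite !add0r !mulrN mulr0 addr0 ler_norml.
by move=> /andP[h _]; lra.
Qed.

Lemma locally_submean_Nln_normc a b : a != 0 ->
  locally_submean (fun y => - ln (normc (a + b * y) ^+ 2)) 0.
Proof.
move=> a0 e e0; have [r r0 hr] := ln_square_near a b a0 e e0.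
exists r => // y /hr; rewrite !add0r !mulrN mulr0 addr0 ler_norml.
by move=> /andP[_ h]; lra.
Qed.

(** By Cauchy-Schwarz against [A], the squared norm is at least the squared modulus of the scalar
    affine function [hdot (A + y *: B) A] over [enorm A ^+ 2], with equality at [y = 0]. The
    logarithm of the latter is a supporting function. *)
Lemma locally_submean_ln_enorm n (A B : 'rV[R[i]]_n) : A != 0 ->
  locally_submean (fun y => ln (enorm (A + y *: B) ^+ 2)) 0.
Proof.
move=> A0; have a0 : 0 < enorm A by rewrite enorm_gt0.
pose a : R[i] := (enorm A ^+ 2)%:C; pose b := hdot B A.
have na : normc a = enorm A ^+ 2 by rewrite normc_real ger0_norm// sqr_ge0.
apply: (locally_submean_support _ (fun y =>
   ln (normc (a + b * y) ^+ 2) + - ln (enorm A ^+ 2))).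
- rewrite mulr0 addr0 scale0r addr0 na.
  by rewrite (lnXn 2 (exprn_gt0 2 a0)) mulr2n addrK.
- exists (normc a / (normc b + 1)).
    by rewrite divr_gt0 ?na ?exprn_gt0// ltr_wpDl ?normc_ge0.
  move=> y; rewrite subr0 ltr_pdivlMr ?ltr_wpDl ?normc_ge0// => hy.
  have p : 0 < normc (a + b * y).
    have := le_normcD (a + b * y) (- (b * y)).
    rewrite addrK normcN Normc.normcM; have := normc_ge0 y; nra.
  have CS := hdot_CS (A + y *: B) A.
  rewrite hdotDl hdotZl hdotxx -/a -/b (mulrC y) in CS.
  have p2 : 0 < enorm (A + y *: B).
    by have := lt_le_trans p CS; rewrite pmulr_lgt0.
  rewrite lerBlDr -lnM ?posrE ?exprn_gt0// ler_ln ?posrE ?mulr_gt0 ?exprn_gt0//.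
  by rewrite -exprMn ler_pXn2r// ?nnegrE ?mulr_ge0// ?normc_ge0 ?enorm_ge0.
- apply: locally_submeanD; last exact: locally_submean_cst.
  by apply: locally_submean_ln_normc; rewrite -normc_gt0 na exprn_gt0.
Qed.

End LogSubmean.

(** * From the local four-point condition to plurisubharmonicity *)

Section LocalToGlobal.
Context {R : realType} {n : nat}.
Local Notation Cn := 'rV[R[i]]_n.
Implicit Types (z w : Cn) (D : set Cn).
Local Notation mu := (@lebesgue_measure R).

Lemma lne_lt_expR (r a : R) : (lne r%:E < a%:E)%E = (r < expR a).
Proof.
have [r0|r0] := leP r 0.
  by rewrite le0_lneNy ?lee_fin// ltNyr (le_lt_trans r0) ?expR_gt0.
by rewrite lne_EFin// lte_fin -[LHS]ltr_expR lnK.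
Qed.

(* The bounded truncations [ln (max v e)] are continuous, so that the mean value
   inequality for them passes to the limit [e -> 0] by monotone convergence. *)
Lemma lne_mean (f : R -> R) (T c : R) : 0 < T -> continuous f ->
  (forall t, 0 <= f t < 1) -> 0 <= c ->
  (forall m : nat, ln (Num.max c m.+1%:R^-1) <=
     T^-1 * \int[mu]_(t in `[0, T]) ln (Num.max (f t) m.+1%:R^-1)) ->
  (lne c%:E <= (T^-1)%:E * \int[mu]_(t in `[0%R, T]) lne (f t)%:E)%E.
Proof.
move=> T0 cf f01 c0 hm.
have mp (m : nat) : 0 < m.+1%:R^-1 :> R by rewrite invr_gt0.
have mle1 (m : nat) : m.+1%:R^-1 <= 1 :> R by rewrite invf_le1// ler1n.
(* As [f] is below 1, changing the sign gives nonnegative functions increasing with [m], as monotone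
   convergence requires. *)
pose F (m : nat) (t : R) : \bar R := (- ln (Num.max (f t) m.+1%:R^-1))%:E.
have F0 m t : (0 <= F m t)%E.
  rewrite lee_fin oppr_ge0 ln_le0// ge_max mle1 andbT.
  by have /andP[_ /ltW] := f01 t.
have Fnd t : nondecreasing_seq (F^~ t).
  move=> k m km; rewrite lee_fin lerN2 ler_ln ?posrE ?lt_max ?mp ?orbT//.
  by rewrite ge_max le_max lexx/= le_max lef_pV2 ?posrE// ler_nat ltnS km orbT.
have Flim t : limn (F^~ t) = (- lne (f t)%:E)%E.
  have /cvg_lim -> // := ereal_nondecreasing_cvgn (Fnd t).
  have /andP[ft0 ft1] := f01 t.
  move: ft0; rewrite le_eqVlt => /predU1P[ft0|ft0].
    rewrite -ft0 le0_lneNy//=; apply/eq_infty => r.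
    apply: (@le_trans _ _ (F (Num.truncn (expR r)) t)); last first.
      by apply: ereal_sup_ubound; exists (Num.truncn (expR r)).
    rewrite /F -ft0 max_r ?(ltW (mp _))// lnV ?posrE// opprK lee_fin.
    by rewrite -ler_expR lnK ?posrE// ltW//; exact/real_truncnS_gt/num_real.
  rewrite lne_EFin//; apply/eqP; rewrite eq_le; apply/andP; split.
    apply: ge_ereal_sup => _ [m _ <-].
    by rewrite lee_fin lerN2 ler_ln ?posrE ?lt_max ?ft0// le_max lexx.
  apply: ereal_sup_ubound; exists (Num.truncn (f t)^-1) => //=.
  rewrite /F max_l// -[leRHS]invrK lef_pV2 ?posrE ?invr_gt0//.
  by rewrite ltW//; exact/real_truncnS_gt/num_real.
have cF m : continuous (fun t => ln (Num.max (f t) m.+1%:R^-1)).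
  move=> t.
  have c1 : {for t, continuous (fun t => Num.max (f t) m.+1%:R^-1)}.
    apply: (@continuous_max _ _ f (fun=> m.+1%:R^-1)); first exact: cf.
    exact: cst_continuous.
  have c2 : {for Num.max (f t) m.+1%:R^-1, continuous (@ln R)}.
    by apply: continuous_ln; rewrite lt_max mp orbT.
  exact: (continuous_comp c1 c2).
have mF m : measurable_fun (`[0, T]%classic : set R) (F m).
  apply/measurable_EFinP; apply: measurable_funS (continuous_measurable_fun _) => //.
  by move=> t; exact: continuousN (cF m t).
have intF m : (\int[mu]_(t in `[0%R, T]) F m t)%E =
    (- \int[mu]_(t in `[0, T]) ln (Num.max (f t) m.+1%:R^-1))%:E.
  have iF : mu.-integrable `[0, T] (EFin \o (fun t => ln (Num.max (f t) m.+1%:R^-1))).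
    by apply: continuous_compact_integrable;
      [exact: segment_compact|exact: continuous_subspaceT].
  rewrite EFinN /Rintegral fineK; last exact: integrable_fin_num.
  by rewrite /F -integralN//=; exact: integrable_add_def.
have := monotone_convergence mu (measurable_itv `[0, T]) mF
  (fun m t _ => F0 m t) (fun t _ => Fnd t).
under eq_integral do rewrite Flim.
move=> E.
have -> : (\int[mu]_(t in `[0%R, T]) lne (f t)%:E =
    - limn (fun m => \int[mu]_(t in `[0%R, T]) F m t))%E.
  rewrite -E -integral_ge0N; last first.
    move=> t _; rewrite oppe_ge0; have /andP[_ /ltW ft1] := f01 t.
    by rewrite lne_le0 lee_fin.
  by apply: eq_integral => t _; rewrite oppeK.
have cvgF : cvgn (fun m => \int[mu]_(t in `[0%R, T]) F m t)%E.
  apply: ereal_nondecreasing_is_cvgn => k m km.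
  by apply: ge0_le_integral => //; [exact: mF|exact: mF|move=> t _; exact: Fnd].
have [c00|c00] := leP c 0; first by rewrite le0_lneNy ?lee_fin// leNye.
rewrite lne_EFin//.
have : (limn (fun m => \int[mu]_(t in `[0%R, T]) F m t) <= (- (T * ln c))%:E)%E.
  apply: lime_le => //; apply: nearW => m; rewrite intF lee_fin lerN2.
  rewrite -ler_pdivlMl//; apply: le_trans (hm m).
  by rewrite ler_ln ?posrE ?lt_max ?c00// le_max lexx.
move=> h; rewrite -lee_pdivrMl ?invr_gt0// invrK.
by rewrite leeNr -EFinM -EFinN.
Qed.

(** Zeros of [v] need no condition: there the truncated logarithm equals the constant [ln a], which
    also bounds it from below nearby. *)
Lemma plurisubharmonic_lne D (v : Cn -> R) :
  (forall z, D z -> 0 <= v z < 1) ->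
  (forall z, D z -> {for z, continuous v}) ->
  (forall z w, D z -> 0 < v z ->
     locally_submean (fun x => ln (v (z + x *: w))) 0) ->
  plurisubharmonic D (fun w => lne (v w)%:E).
Proof.
move=> v01 cv lv; split.
- move=> z Dz; rewrite /=; case: ifP => // _; exact: ltry.
- move=> z Dz a; rewrite lne_lt_expR => va.
  have := cv z Dz => /cvgr_lt/(_ _ va); apply: filterS => w.
  by rewrite lne_lt_expR.
move=> z w Dzw.
have Dn x : normc x <= 1 -> D (z + x *: w).
  by move=> x1; apply: Dzw; rewrite normr_normc lecR.
have clin x : {for x, continuous (fun x : R[i] => z + x *: w)}.
  move=> P /nbhs_enormP[e e0 he]; apply/nbhs_normcP.
  have w0 : 0 < enorm w + 1 by rewrite ltr_wpDl ?enorm_ge0.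
  exists (e / (enorm w + 1)); first by rewrite divr_gt0.
  move=> y; rewrite ltr_pdivlMr// => yx; apply: he.
  rewrite opprD addrACA subrr add0r -scalerBl enormZ; apply: le_lt_trans yx.
  by rewrite ler_wpM2l ?normc_ge0// lerDl.
apply: lne_mean.
- by rewrite mulr_gt0// pi_gt0.
- move=> t.
  have c3 : {for z + cis t *: w, continuous v}.
    by apply: cv; apply: Dn; rewrite normc_cis.
  exact: (continuous_comp (continuous_cis t) (continuous_comp (clin (cis t)) c3)).
- by move=> t; apply: v01; apply: Dn; rewrite normc_cis.
- have /v01/andP[]// : D z.
  by have := Dn 0; rewrite scale0r addr0 Normc.normc0; apply.
move=> m; set a : R := m.+1%:R^-1.
have a0 : 0 < a by rewrite invr_gt0.
have := @disc_mean _ (fun x => ln (Num.max (v (z + x *: w)) a)).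
rewrite scale0r addr0; apply.
- move=> x x1.
  have c3 : {for z + x *: w, continuous v} by apply: cv; exact: Dn.
  have c1 : {for x, continuous (fun x : R[i] => Num.max (v (z + x *: w)) a)}.
    apply: (@continuous_max _ _ (fun x : R[i] => v (z + x *: w)) (fun=> a));
      last exact: cst_continuous.
    exact: (continuous_comp (clin x) c3).
  have c2 : {for Num.max (v (z + x *: w)) a, continuous (@ln R)}.
    by apply: continuous_ln; rewrite lt_max a0 orbT.
  exact: (continuous_comp c1 c2).
move=> x x1.
have [va|va] := leP (v (z + x *: w)) a.
  apply: (locally_submean_support _ (fun=> ln a)); last exact: locally_submean_cst.
    by rewrite max_r.
  by exists 1 => // y _; rewrite ler_ln ?posrE ?lt_max ?a0 ?orbT// le_max lexx orbT.
have vp : 0 < v (z + x *: w) by exact: lt_trans va.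
have Dx : D (z + x *: w) by apply: Dn; exact: ltW.
apply: (locally_submean_support _ (fun y => ln (v (z + y *: w)))).
- by rewrite max_l// ltW.
- have /nbhs_normcP[r r0 hr] : \forall y \near x, 0 < v (z + y *: w).
    have := continuous_comp (clin x) (cv _ Dx).
    by move=> /cvgr_gt/(_ _ vp).
  exists r => // y /hr vy.
  by rewrite ler_ln ?posrE ?lt_max ?vy// le_max lexx.
have := lv (z + x *: w) w Dx vp.
move=> h e e0; have [r r0 hr] := h e e0; exists r => // y /hr.
by rewrite !add0r scale0r addr0 !scalerDl !addrA.
Qed.

End LocalToGlobal.

(** * Smoothness and Levi forms *)

Section Smoothness.
Context {R : realType} {n : nat}.
Local Notation Cn := 'rV[R[i]]_n.
Implicit Types (z w d q X : Cn) (f g : Cn -> R).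

Lemma real_slice0 f d z : real_slice f d z 0 = f z.
Proof. by rewrite /real_slice scale0r addr0. Qed.

Lemma continuous_enormP f z : {for z, continuous f} <->
  forall e, 0 < e -> exists2 r, 0 < r &
    forall w, enorm (w - z) < r -> `|f z - f w| < e.
Proof.
split=> [cf e e0|H P /nbhs_ballP[e /= e0 he]].
  by have /nbhs_enormP[r r0 hr] := cf _ (nbhsx_ballx (f z) e e0); exists r.
have [r r0 hr] := H e e0; apply/nbhs_enormP; exists r => // w /hr; exact: he.
Qed.

Lemma near_all (P : set Cn) z : (forall w, P w) -> \forall w \near z, P w.
Proof. by move=> h; apply/nbhs_enormP; exists 1. Qed.

Lemma near_slice (P : set Cn) d z :
  (\forall w \near z, P w) -> \forall t \near (0 : R), P (z + t%:C *: d).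
Proof.
move=> /nbhs_enormP[r r0 hr]; have d0 : 0 < enorm d + 1 by rewrite ltr_wpDl ?enorm_ge0.
apply/nbhs_ballP; exists (r / (enorm d + 1)); first by rewrite /= divr_gt0.
move=> t; rewrite /ball /= sub0r normrN ltr_pdivlMr// => td; apply: hr.
rewrite addrC addKr enormZ normc_real; apply: le_lt_trans td.
by rewrite ler_wpM2l// lerDl.
Qed.

Lemma near_real_slice f g d z : (\forall w \near z, f w = g w) ->
  {near (0 : R), real_slice f d z =1 real_slice g d z}.
Proof. by move=> /near_slice fg; apply: fg. Qed.

Lemma partial_near f g d z : (\forall w \near z, f w = g w) ->
  partial d f z = partial d g z.
Proof.
by move=> fg; rewrite /partial !derive1E; apply/near_eq_derive/near_real_slice.
Qed.

Lemma derivable_near f g d z : (\forall w \near z, f w = g w) ->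
  derivable (real_slice f d z) 0 1 -> derivable (real_slice g d z) 0 1.
Proof. by move=> fg; apply/near_eq_derivable/near_real_slice. Qed.

Lemma Ck_near_ext k f g z : (\forall w \near z, f w = g w) ->
  Ck_near k f z -> Ck_near k g z.
Proof.
elim: k f g => [|k IH] f g fg [cf hf]; (split;
  first by apply: filterS2 (near_join fg) cf => w fgw cfw;
    rewrite /prop_for /continuous_at -(nbhs_singleton fgw);
    exact: cvg_trans (near_eq_cvg fgw) cfw) => //.
move=> d rd; have [df cdf] := hf d rd; split.
  by apply: filterS2 (near_join fg) df => w; exact: derivable_near.
by apply: IH cdf; apply: filterS (near_join fg) => w; exact: partial_near.
Qed.

Lemma Ck_nearW k f z : Ck_near k.+1 f z -> Ck_near k f z.
Proof.
elim: k f => [|k IH] f [cf hf]; split=> // d rd.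
by have [df cdf] := hf d rd; split=> //; exact: IH.
Qed.

Lemma derivable_sliceD f g d z : derivable (real_slice f d z) 0 1 ->
  derivable (real_slice g d z) 0 1 ->
  derivable (real_slice (fun w => f w + g w) d z) 0 1.
Proof.
move=> df dg; have -> : real_slice (fun w => f w + g w) d z =
  real_slice f d z + real_slice g d z by [].
exact: (derivableD df dg).
Qed.

Lemma derivable_sliceM f g d z : derivable (real_slice f d z) 0 1 ->
  derivable (real_slice g d z) 0 1 ->
  derivable (real_slice (fun w => f w * g w) d z) 0 1.
Proof.
move=> df dg; have -> : real_slice (fun w => f w * g w) d z =
  real_slice f d z * real_slice g d z by [].
exact: (derivableM df dg).
Qed.

Lemma partialD f g d z : derivable (real_slice f d z) 0 1 ->
  derivable (real_slice g d z) 0 1 ->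
  partial d (fun w => f w + g w) z = partial d f z + partial d g z.
Proof. by move=> df dg; rewrite /partial !derive1E; exact: (deriveD df dg). Qed.

Lemma partialM f g d z : derivable (real_slice f d z) 0 1 ->
  derivable (real_slice g d z) 0 1 ->
  partial d (fun w => f w * g w) z = f z * partial d g z + g z * partial d f z.
Proof.
move=> df dg; rewrite /partial !derive1E.
by have := deriveM df dg; rewrite !real_slice0.
Qed.

Lemma partialV g d z : g z != 0 -> derivable (real_slice g d z) 0 1 ->
  partial d (fun w => (g w)^-1) z = - ((g z)^-1 * (g z)^-1 * partial d g z).
Proof.
move=> g0 dg; rewrite /partial !derive1E.
have g0' : real_slice g d z 0 != 0 by rewrite real_slice0.
have := deriveV g0' dg; rewrite !real_slice0 => ->.
by rewrite scaleNr -exprVn expr2.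
Qed.

Lemma Ck_near_cst k (c : R) z : Ck_near k (fun=> c) z.
Proof.
elim: k c => [|k IH] c.
  by split=> //; apply: near_all => w; exact: cst_continuous.
split; first by apply: near_all => w; exact: cst_continuous.
move=> d _; split; first by apply: near_all => w; exact: derivable_cst.
apply: (Ck_near_ext _ (fun=> 0)); last exact: IH.
by apply: near_all => w; rewrite /partial derive1_cst.
Qed.

Lemma Ck_nearD k f g z : Ck_near k f z -> Ck_near k g z ->
  Ck_near k (fun w => f w + g w) z.
Proof.
elim: k f g => [|k IH] f g [cf hf] [cg hg].
  by split=> //; apply: filterS2 cf cg => w; exact: continuousD.
split; first by apply: filterS2 cf cg => w; exact: continuousD.
move=> d rd; have [df pf] := hf d rd; have [dg pg] := hg d rd; split.
  by apply: filterS2 df dg => w; exact: derivable_sliceD.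
apply: (Ck_near_ext _ _ _ _ _ (IH _ _ pf pg)).
by apply: filterS2 df dg => w dfw dgw; rewrite partialD.
Qed.

Lemma Ck_nearM k f g z : Ck_near k f z -> Ck_near k g z ->
  Ck_near k (fun w => f w * g w) z.
Proof.
elim: k f g => [|k IH] f g Cf Cg; have [cf hf] := Cf; have [cg hg] := Cg.
  by split=> //; apply: filterS2 cf cg => w; exact: continuousM.
split; first by apply: filterS2 cf cg => w; exact: continuousM.
move=> d rd; have [df pf] := hf d rd; have [dg pg] := hg d rd; split.
  by apply: filterS2 df dg => w; exact: derivable_sliceM.
have := Ck_nearD _ _ _ _ (IH _ _ (Ck_nearW _ _ _ Cf) pg) (IH _ _ (Ck_nearW _ _ _ Cg) pf).
apply: Ck_near_ext.
by apply: filterS2 df dg => w dfw dgw; rewrite partialM.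
Qed.

Lemma continuous_neq0_near g z : {for z, continuous g} -> g z != 0 ->
  \forall w \near z, g w != 0.
Proof.
move=> /cvgrPdist_lt cg; rewrite -normr_gt0 => /cg; apply: filterS => w.
by apply: contraTneq => ->; rewrite subr0 ltxx.
Qed.

Lemma Ck_nearV k g z : g z != 0 -> Ck_near k g z ->
  Ck_near k (fun w => (g w)^-1) z.
Proof.
move=> g0; elim: k => [|k IH] Cg; have [cg hg] := Cg;
  have gn0 : \forall w \near z, g w != 0
    by exact: continuous_neq0_near (nbhs_singleton cg) g0.
  by split=> //; apply: filterS2 gn0 cg => w; exact: continuousV.
split; first by apply: filterS2 gn0 cg => w; exact: continuousV.
move=> d rd; have [dg pg] := hg d rd; split.
  apply: filterS2 gn0 dg => w gw dgw.
  by apply: (@derivableV _ _ (real_slice g d w)) => //; rewrite real_slice0.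
have CV := IH (Ck_nearW _ _ _ Cg).
have := Ck_nearM _ _ _ _ (Ck_near_cst _ (-1) _)
  (Ck_nearM _ _ _ _ (Ck_nearM _ _ _ _ CV CV) pg).
apply: Ck_near_ext.
by apply: filterS2 gn0 dg => w gw dgw; rewrite partialV// mulN1r.
Qed.

Lemma derivable_quadratic (f : R -> R) (a b c : R) :
  (forall t, f t = a + t * b + t ^+ 2 * c) ->
  derivable f 0 1 /\ derive1 f 0 = b.
Proof.
move=> fE; have -> : f = fun t => a + t * b + t ^+ 2 * c by apply/funext.
suff H : is_derive (0 : R) (1 : R) (fun t : R => a + t * b + t ^+ 2 * c) b.
  by split; [exact: ex_derive|rewrite derive1E; exact: derive_val].
have h1 := is_derive_id (0 : R) (1 : R).
have := is_deriveD (is_deriveD (is_derive_cst a (0 : R) (1 : R))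
  (is_deriveM h1 (is_derive_cst b (0 : R) (1 : R))))
  (is_deriveM (is_deriveM h1 h1) (is_derive_cst c (0 : R) (1 : R))).
move=> H; apply: is_derive_eq.
by rewrite !scaler0 !scale0r addr0 scaler0 !add0r addr0 -[b%:A]/(b * 1) mulr1.
Qed.

(** The derivative in direction [d] can be read off as [b^~ d], so no chain rule in several
    variables is needed for squared norms. *)
Lemma Ck_near_quadratic k f (b : Cn -> Cn -> R) (c : Cn -> R) z :
  (forall w d t, f (w + t%:C *: d) = f w + t * b w d + t ^+ 2 * c d) ->
  continuous f -> (forall d, Ck_near k (b^~ d) z) -> Ck_near k.+1 f z.
Proof.
move=> fE cf Cb; split; first by apply: near_all => w; exact: cf.
move=> d rd; split.
  by apply: near_all => w; have [] := derivable_quadratic _ _ _ _ (fE w d).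
apply: Ck_near_ext (Cb d); apply: near_all => w.
by have [_ <-] := derivable_quadratic _ _ _ _ (fE w d).
Qed.

Lemma Ck_near_affine k f (m : Cn -> R) z :
  (forall w d t, f (w + t%:C *: d) = f w + t * m d) ->
  continuous f -> Ck_near k f z.
Proof.
move=> fE cf; case: k => [|k]; first by split=> //; apply: near_all => w; exact: cf.
apply: (Ck_near_quadratic _ _ (fun=> m) (fun=> 0)) => //.
  by move=> w d t; rewrite fE mulr0 addr0.
by move=> d; exact: Ck_near_cst.
Qed.

Lemma lipschitz_enorm_continuous f (K : R) :
  (forall z w, `|f z - f w| <= K * enorm (z - w)) -> continuous f.
Proof.
move=> fK z; apply/continuous_enormP => e e0.
have K0 : 0 < `|K| + 1 by rewrite ltr_wpDl.
exists (e / (`|K| + 1)); first by rewrite divr_gt0.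
move=> w; rewrite ltr_pdivlMr// => wz; apply: le_lt_trans (fK _ _) _.
rewrite enormB; apply: le_lt_trans wz; rewrite mulrC ler_wpM2l ?enorm_ge0//.
by apply: le_trans (ler_norm _) _; rewrite lerDl.
Qed.

Lemma continuous_Re_hdot (a : Cn) : continuous (fun w => Re (hdot w a)).
Proof.
apply: (lipschitz_enorm_continuous _ (enorm a)) => z w.
by rewrite -cReN -cReD -hdotBl mulrC Re_hdot_le.
Qed.

Lemma Ck_near_Re_hdot k (a : Cn) (c : R) z :
  Ck_near k (fun w => Re (hdot w a) + c) z.
Proof.
apply: Ck_nearD; last exact: Ck_near_cst.
apply: (Ck_near_affine _ _ (fun d => Re (hdot d a))).
  by move=> w d t; rewrite hdotDl hdotZl cReD cReZ.
exact: continuous_Re_hdot.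
Qed.

Lemma Ck_near_normc_hdot k (a : Cn) (c : R[i]) z :
  Ck_near k (fun w => normc (hdot w a - c) ^+ 2) z.
Proof.
have h1 := Ck_near_Re_hdot k a (- Re c) z.
(* Conjugate linearity turns ['i] into [- 'i], so this real part is the imaginary part of
   [hdot w a]. *)
have h2 := Ck_near_Re_hdot k ('i *: a) (- Im c) z.
have := Ck_nearD _ _ _ _ (Ck_nearM _ _ _ _ h1 h1) (Ck_nearM _ _ _ _ h2 h2).
apply: Ck_near_ext; apply: near_all => w.
rewrite normc_sqr !cReD !cImD cReN cImN !expr2 hdotZr -complexiE cReM cReJ cImJ /=.
by rewrite mul0r mulN1r sub0r opprK.
Qed.

Lemma ddbarE (v : Cn -> R) z j k (xx yy xy yx : R) :
  partial (xdir j) (partial (xdir k) v) z = xx ->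
  partial (ydir j) (partial (ydir k) v) z = yy ->
  partial (xdir j) (partial (ydir k) v) z = xy ->
  partial (ydir j) (partial (xdir k) v) z = yx ->
  ddbar v z j k = (4%:R)^-1 * ((xx + yy) +i* (xy - yx)).
Proof. by move=> <- <- <- <-. Qed.

Section Levi.
Variables (L : Cn -> Cn) (K : R) (q : Cn).
Hypothesis linL : linear L.
Hypothesis LK : forall z, enorm (L z) <= K * enorm z.

Let N w := enorm (L (w - q)) ^+ 2.

Let LZ (a : R[i]) z : L (a *: z) = a *: L z.
Proof.
have L0 : L 0 = 0.
  by have := linL (-1) 0 0; rewrite scaler0 addr0 scaleN1r addNr.
by have := linL a z 0; rewrite !addr0 L0 addr0.
Qed.

Let LD z w : L (z + w) = L z + L w.
Proof. by have := linL 1 z w; rewrite !scale1r. Qed.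

Let LB z w : L (z - w) = L z - L w.
Proof. by rewrite LD -scaleN1r LZ scaleN1r. Qed.

Let NE w d t :
  N (w + t%:C *: d) = N w + t * (2 * Re (hdot (L (w - q)) (L d)))
    + t ^+ 2 * enorm (L d) ^+ 2.
Proof.
rewrite /N addrAC (LD (w - q)) LZ enormD_sqr enormZ normc_real exprMn.
rewrite real_normK ?num_real//.
by rewrite hdotZr conjC_realc cReZ; ring.
Qed.

Lemma continuous_enormL : continuous (fun w => enorm (L (w - q))).
Proof.
apply: (lipschitz_enorm_continuous _ K) => z w.
apply: le_trans (enormB_ler _ _) (le_trans _ (LK (z - w))).
by rewrite -LB opprB addrA subrK.
Qed.

Let bE d w : 2 * Re (hdot (L (w - q)) (L d)) =
   2 * (Re (hdot (L w) (L d)) - Re (hdot (L q) (L d))).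
Proof. by rewrite LB hdotBl cReD cReN. Qed.

Let Cb k d z : Ck_near k (fun w => 2 * Re (hdot (L (w - q)) (L d))) z.
Proof.
apply: (Ck_near_affine _ _ (fun e => 2 * Re (hdot (L e) (L d)))).
  by move=> w e t; rewrite addrAC (LD (w - q)) LZ hdotDl hdotZl cReD cReZ; ring.
apply: (lipschitz_enorm_continuous _ (2 * (K * enorm (L d)))) => z' w.
rewrite !bE -mulrBr normrM ger0_norm// -mulrA ler_pM2l//.
rewrite opprD opprK addrACA addNr addr0 -cReN -cReD -hdotBl -LB.
apply: le_trans (Re_hdot_le _ _) _; rewrite mulrAC.
by rewrite ler_wpM2r ?enorm_ge0.
Qed.

Lemma Ck_near_enormL k z : Ck_near k.+1 N z.
Proof.
apply: (Ck_near_quadratic _ _ _ _ _ NE) => [|d]; last exact: Cb.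
by move=> w; exact: (continuousM (continuous_enormL w) (continuous_enormL w)).
Qed.

Let partialN d w : partial d N w = 2 * Re (hdot (L (w - q)) (L d)).
Proof. by have [_ <-] := derivable_quadratic _ _ _ _ (NE w d). Qed.

Let partial2N d e w : partial e (partial d N) w = 2 * Re (hdot (L e) (L d)).
Proof.
have -> : partial d N = fun w => 2 * Re (hdot (L (w - q)) (L d)).
  by apply/funext => w'; rewrite partialN.
have [|_ <-//] := derivable_quadratic
  (real_slice (fun w => 2 * Re (hdot (L (w - q)) (L d))) e w)
  (2 * Re (hdot (L (w - q)) (L d))) (2 * Re (hdot (L e) (L d))) 0.
move=> t; rewrite /real_slice addrAC (LD (w - q)) LZ hdotDl hdotZl cReD cReZ; ring.
Qed.

Variable W : Cn -> R.
Hypothesis CW : Ck_near 2 W q.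

Let partial2NW d e : real_dirs d -> real_dirs e ->
  partial e (partial d (fun w => N w * W w)) q = 2 * Re (hdot (L e) (L d)) * W q.
Proof.
move=> rd re; have [_ hW] := CW; have [dW pW] := hW d rd.
have [_ hN] := Ck_near_enormL 1 q; have [dN pN] := hN d rd.
have -> : partial e (partial d (fun w => N w * W w)) q =
  partial e (fun w => N w * partial d W w + W w * partial d N w) q.
  by apply: partial_near; apply: filterS2 dN dW => w; exact: partialM.
have D1 : derivable (real_slice N e q) 0 1 by exact: nbhs_singleton (hN e re).1.
have D2 : derivable (real_slice W e q) 0 1 by exact: nbhs_singleton (hW e re).1.
have D3 : derivable (real_slice (partial d W) e q) 0 1.
  by have [_ /(_ e re)[/nbhs_singleton]] := pW.
have D4 : derivable (real_slice (partial d N) e q) 0 1.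
  by have [_ /(_ e re)[/nbhs_singleton]] := pN.
have L0 : L 0 = 0 by have := LZ 0 0; rewrite !scale0r.
rewrite partialD.
- rewrite (partialM _ _ _ _ D1 D3) (partialM _ _ _ _ D2 D4).
  rewrite partial2N !partialN /N subrr L0 enorm0 !hdot0l /=.
  by ring.
- exact: (derivable_sliceM _ _ _ _ D1 D3).
- exact: (derivable_sliceM _ _ _ _ D2 D4).
Qed.

Let h a b := hdot (L a) (L b).

(** [N] and its first derivatives vanish at [q], so the Leibniz rule leaves only second derivatives
    of [N] times [W q]: the Levi form is exact and no derivative of [W] enters it. *)
Lemma Levi_quadratic (v : Cn -> R) X : (\forall w \near q, v w = N w * W w) ->
  Ck_near 2 v q /\ Levi v q X = (enorm (L X) ^+ 2 * W q)%:C.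
Proof.
move=> vE; split.
  apply: (Ck_near_ext _ (fun w => N w * W w)).
    by apply: filterS vE => w ->.
  exact: (Ck_nearM _ _ _ _ (Ck_near_enormL 1 q) CW).
have xd j : real_dirs (xdir j : Cn) by left; exists j.
have yd j : real_dirs (ydir j : Cn) by right; exists j.
have P d e : real_dirs d -> real_dirs e ->
    partial e (partial d v) q = 2 * Re (h e d) * W q.
  move=> rd re; rewrite -(partial2NW _ _ rd re); apply: partial_near.
  by apply: filterS (near_join vE) => w; exact: partial_near.
(* Each real second derivative is twice a real part of [h]; with [L] complex linear, the four of
   them recombine into [h] itself. *)
have ddE j k : ddbar v q j k = h (xdir j) (xdir k) * (W q)%:C.
  have Ly l : L (ydir l) = 'i%C *: L (xdir l) by rewrite /ydir -complexiE LZ.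
  rewrite (ddbarE _ _ _ _ _ _ _ _ (P _ _ (xd k) (xd j)) (P _ _ (yd k) (yd j))
    (P _ _ (yd k) (xd j)) (P _ _ (xd k) (yd j))) /h !Ly !hdotZl !hdotZr.
  move: (hdot (L (xdir j)) (L (xdir k))) => c.
  have c4 : (4%:R : R[i])^-1 = ((4 : R)^-1)%:C by rewrite fmorphV rmorph_nat.
  rewrite c4; case: c => a b.
  by apply: complex_ext; rewrite ?cReM ?cImM ?cReJ ?cImJ /=; field.
have XE : X = \sum_j X 0 j *: xdir j by exact: row_sum_delta.
have Lsum (s : seq 'I_n) (F : 'I_n -> Cn) : L (\sum_(j <- s) F j) = \sum_(j <- s) L (F j).
  elim: s => [|j s IH]; last by rewrite !big_cons LD IH.
  by rewrite !big_nil; have := LZ 0 0; rewrite !scale0r.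
have hsuml (s : seq 'I_n) (F : 'I_n -> Cn) b :
    hdot (\sum_(j <- s) F j) b = \sum_(j <- s) hdot (F j) b.
  elim: s => [|j s IH]; last by rewrite !big_cons hdotDl IH.
  by rewrite !big_nil hdot0l.
have hsumr (s : seq 'I_n) (F : 'I_n -> Cn) b :
    hdot b (\sum_(j <- s) F j) = \sum_(j <- s) hdot b (F j).
  elim: s => [|j s IH]; last by rewrite !big_cons hdotDr IH.
  by rewrite !big_nil hdotC hdot0l rmorph0.
have LX : L X = \sum_j X 0 j *: L (xdir j).
  by rewrite {1}XE Lsum; apply: eq_bigr => j _; rewrite LZ.
rewrite rmorphM /= -hdotxx {1}LX hsuml mulr_suml.
apply: eq_bigr => j _; rewrite {1}LX hsumr mulr_suml.
apply: eq_bigr => k _; rewrite ddE hdotZl hdotZr /h.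
move: (hdot (L (xdir j)) (L (xdir k))) (X 0 j) (X 0 k)^* (W q)%:C => a b c w.
ring.
Qed.

End Levi.
End Smoothness.

(** * Geometry of the domain near the boundary point *)

Section StrictDifferentiability.
Context {R : realType} {n : nat}.
Local Notation Cn := 'rV[R[i]]_n.
Implicit Types (x y z w d u : Cn) (f : Cn -> R).

Lemma xdir_unit (j : 'I_n) : enorm (xdir j : Cn) = 1.
Proof.
rewrite /enorm hdotxx_sum (bigD1 j)//= big1 ?addr0; last first.
  by move=> k kj; rewrite !mxE (negbTE kj) andbF Normc.normc0 expr0n.
by rewrite !mxE !eqxx Normc.normc1 expr1n sqrtr1.
Qed.

Lemma ydir_unit (j : 'I_n) : enorm (ydir j : Cn) = 1.
Proof.
by rewrite enormZ xdir_unit mulr1 -complexiE /= expr0n expr1n add0r sqrtr1.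
Qed.

(** [partial] differentiates at parameter 0 only, so the slice is recentred at each of its points
    before the mean value theorem is applied. *)
Lemma real_slice_is_derive f d x (s : R) :
  derivable (real_slice f d (x + s%:C *: d)) 0 1 ->
  is_derive s (1 : R) (real_slice f d x) (partial d f (x + s%:C *: d)).
Proof.
move=> df; pose g := real_slice f d (x + s%:C *: d).
have dg : is_derive (0 : R) (1 : R) g (partial d f (x + s%:C *: d)).
  by rewrite /partial derive1E; exact: derivableP df.
have -> : real_slice f d x = g \o (fun t => t - s).
  apply/funext => t; rewrite /g /real_slice /= -addrA -scalerDl.
  by congr (f (x + _ *: d)); rewrite -rmorphD /= addrC subrK.
have h : is_derive s (1 : R) (fun t : R => t - s) 1.
  have := is_deriveD (is_derive_id s (1 : R)) (is_derive_cst (- s) s (1 : R)).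
  by rewrite addr0.
have dg' : is_derive (s - s) (1 : R) g (partial d f (x + s%:C *: d)) by rewrite subrr.
by have := is_derive1_comp (f := g) (g := fun t : R => t - s) dg' h; rewrite mulr1.
Qed.

Lemma slice_increment f d x (m e t : R) : 0 <= e ->
  (forall s, `|s| <= `|t| -> derivable (real_slice f d (x + s%:C *: d)) 0 1) ->
  (forall s, `|s| <= `|t| -> `|partial d f (x + s%:C *: d) - m| <= e) ->
  `|f (x + t%:C *: d) - f x - t * m| <= e * `|t|.
Proof.
move=> e0 df dm; pose g := real_slice f d x.
have gt : f (x + t%:C *: d) = g t by [].
have g0 : f x = g 0 by rewrite /g real_slice0.
have D s : `|s| <= `|t| -> is_derive s (1 : R) g (partial d f (x + s%:C *: d)).
  by move=> /df; exact: real_slice_is_derive.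
have C s : `|s| <= `|t| -> {for s, continuous g}.
  by move=> /D[dg _]; exact/differentiable_continuous/derivable1_diffP.
rewrite gt g0; have [t0|t0] := leP 0 t.
  rewrite (ger0_norm t0) in D C dm *.
  have bd s : s \in `[0, t] -> `|s| <= t.
    by rewrite in_itv/= => /andP[s0 st]; rewrite ger0_norm.
  have [||c ct ->] := @MVT_segment _ g (fun s => partial d f (x + s%:C *: d)) 0 t t0.
  - by move=> s st; apply/D/bd; exact: subset_itv_oo_cc.
  - by apply: continuous_in_subspaceT => s /set_mem st; apply: C; exact: bd.
  rewrite subr0 (mulrC t) -mulrBl normrM (ger0_norm t0).
  by apply: (ler_wpM2r t0); apply: dm; exact: bd.
have nt : `|t| = - t by rewrite ltr0_norm.
rewrite nt in D C dm *.
have bd s : s \in `[t, 0] -> `|s| <= - t.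
  by rewrite in_itv/= => /andP[s0 st]; rewrite ler0_norm// lerN2.
have [||c ct E] := @MVT_segment _ g (fun s => partial d f (x + s%:C *: d)) t 0 (ltW t0).
- by move=> s st; apply/D/bd; exact: subset_itv_oo_cc.
- by apply: continuous_in_subspaceT => s /set_mem st; apply: C; exact: bd.
have -> : g t - g 0 = partial d f (x + c%:C *: d) * t by rewrite -opprB E; ring.
rewrite (mulrC t) -mulrBl normrM nt.
have nt0 : 0 <= - t by rewrite oppr_ge0 ltW.
by apply: (ler_wpM2r nt0); apply: dm; exact: bd.
Qed.

Lemma near_forall_ord (P : 'I_n -> set Cn) z :
  (forall j, \forall w \near z, P j w) -> \forall w \near z, forall j, P j w.
Proof.
move=> hP; suff H (s : seq 'I_n) : \forall w \near z, forall j, j \in s -> P j w.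
  by apply: filterS (H (enum 'I_n)) => w h j; apply: h; rewrite mem_enum.
elim: s => [|j s IH]; first exact: near_all.
apply: filterS2 (hP j) IH => w Pj IHw k; rewrite inE => /predU1P[->//|]; exact: IHw.
Qed.

Lemma row_decomposition u :
  u = \sum_j ((Re (u 0 j))%:C *: xdir j + (Im (u 0 j))%:C *: ydir j).
Proof.
rewrite {1}(row_sum_delta u); apply: eq_bigr => j _.
rewrite /ydir scalerA -scalerDl; congr (_ *: _).
by rewrite -complexiE {1}(complexE (u 0 j)) mulrC.
Qed.

Lemma enormD_shift x v z : enorm (x + v - z) <= enorm (x - z) + enorm v.
Proof. by rewrite addrAC enormD. Qed.

(** Bookkeeping for a path parallel to the axes: [E] is the distance of the current point from [z],
    [A] and [B] are the two moves in one complex coordinate, [S] is the length still to go. *)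
Let ineq1 (E A B S r : R) : 0 <= B -> 0 <= S -> E + (A + B + S) < r -> E + A < r.
Proof. by lra. Qed.

Let ineq2 (E E1 A B S r : R) :
  0 <= S -> E + (A + B + S) < r -> E1 <= E + A -> E1 + B < r.
Proof. by lra. Qed.

Let ineq3 (E E1 E2 A B S r : R) :
  E + (A + B + S) < r -> E1 <= E + A -> E2 <= E1 + B -> E2 + S < r.
Proof. by lra. Qed.

Let triangle3 (f0 f1 f2 f3 a b c e A B S : R) :
  `|f1 - f0 - a| <= e * A -> `|f2 - f1 - b| <= e * B ->
  `|f3 - f2 - c| <= e * S ->
  `|f3 - f0 - (a + b + c)| <= e * (A + B + S).
Proof.
rewrite !ler_norml => /andP[a1 b1] /andP[a2 b2] /andP[a3 b3].
by apply/andP; split; lra.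
Qed.

(** The segment from [x] to [x + u] is replaced by moves along the real axes, with the mean value
    theorem on each. The base point [x] varies too, because the exterior cone is wanted at every
    point near [p] with the same axis. *)
Lemma C1_strictly_differentiable f z : Ck_near 1 f z ->
  forall e, 0 < e -> exists2 r, 0 < r & forall x u,
    enorm (x - z) < r -> enorm (x + u - z) < r ->
    `|f (x + u) - f x - \sum_j (Re (u 0 j) * partial (xdir j) f z
                               + Im (u 0 j) * partial (ydir j) f z)|
      <= e * enorm u.
Proof.
move=> [_ hf] e e0.
have n0 : 0 < (2 * n.+1%:R : R) by rewrite mulr_gt0.
pose e' := e / (2 * n.+1%:R); have e'0 : 0 < e' by rewrite divr_gt0.
have near1 d : real_dirs d -> \forall w \near z,
    derivable (real_slice f d w) 0 1 /\ `|partial d f w - partial d f z| <= e'.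
  move=> rd; have [df [/nbhs_singleton/continuous_enormP cf _]] := hf d rd.
  have [r r0 hr] := cf _ e'0.
  have cw : \forall w \near z, `|partial d f z - partial d f w| < e'.
    by apply/nbhs_enormP; exists r.
  by apply: filterS2 df cw => w dfw cfw; split=> //; rewrite distrC ltW.
have xd j : real_dirs (xdir j : Cn) by left; exists j.
have yd j : real_dirs (ydir j : Cn) by right; exists j.
have [r r0 hr] : exists2 r, 0 < r & forall w, enorm (w - z) < r -> forall j : 'I_n,
   (derivable (real_slice f (xdir j) w) 0 1 /\
      `|partial (xdir j) f w - partial (xdir j) f z| <= e') /\
   (derivable (real_slice f (ydir j) w) 0 1 /\
      `|partial (ydir j) f w - partial (ydir j) f z| <= e').
  apply/nbhs_enormP; apply: near_forall_ord => j.
  by apply: filterS2 (near1 _ (xd j)) (near1 _ (yd j)) => w.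
have step x d (t : R) : enorm d = 1 -> enorm (x - z) + `|t| < r ->
    (forall w, enorm (w - z) < r -> derivable (real_slice f d w) 0 1 /\
      `|partial d f w - partial d f z| <= e') ->
    `|f (x + t%:C *: d) - f x - t * partial d f z| <= e' * `|t|.
  move=> d1 xt hd; have near s : `|s| <= `|t| -> enorm (x + s%:C *: d - z) < r.
    move=> st; rewrite addrAC; apply: le_lt_trans (enormD _ _) _.
    by rewrite enormZ d1 mulr1 normc_real (le_lt_trans _ xt)// lerD2l.
  by apply: slice_increment => [|s /near/hd[]|s /near/hd[]]//; exact: ltW.
pose a u j := `|Re (u 0 j)| + `|Im (u 0 j)|.
have path (s : seq 'I_n) x u : enorm (x - z) + \sum_(j <- s) a u j < r ->
    `|f (x + \sum_(j <- s) ((Re (u 0 j))%:C *: xdir j + (Im (u 0 j))%:C *: ydir j))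
      - f x - \sum_(j <- s) (Re (u 0 j) * partial (xdir j) f z
                               + Im (u 0 j) * partial (ydir j) f z)|
      <= e' * \sum_(j <- s) a u j.
  elim: s x => [|j s IH] x.
    by move=> _; rewrite !big_nil addr0 subrr subr0 normr0 mulr0.
  rewrite !big_cons => hx.
  pose S := \sum_(i <- s) a u i.
  have S0 : 0 <= S by apply: sumr_ge0 => i _; rewrite addr_ge0.
  pose A := `|Re (u 0 j)|; pose B := `|Im (u 0 j)|.
  have A0 : 0 <= A by exact: normr_ge0.
  have B0 : 0 <= B by exact: normr_ge0.
  have {}hx : enorm (x - z) + (A + B + S) < r by exact: hx.
  pose x1 := x + (Re (u 0 j))%:C *: xdir j.
  have x1z : enorm (x1 - z) <= enorm (x - z) + A.
    have := enormD_shift x ((Re (u 0 j))%:C *: xdir j) z.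
    by rewrite enormZ xdir_unit mulr1 normc_real.
  pose x2 := x1 + (Im (u 0 j))%:C *: ydir j.
  have x2z : enorm (x2 - z) <= enorm (x1 - z) + B.
    have := enormD_shift x1 ((Im (u 0 j))%:C *: ydir j) z.
    by rewrite enormZ ydir_unit mulr1 normc_real.
  have p1 := ineq1 _ _ _ _ _ B0 S0 hx.
  have p2 := ineq2 _ _ _ _ _ _ S0 hx x1z.
  have p3 := ineq3 _ _ _ _ _ _ _ hx x1z x2z.
  have h1 := step x (xdir j) (Re (u 0 j)) (xdir_unit j) p1
    (fun w hw => (hr w hw j).1).
  have h2 := step x1 (ydir j) (Im (u 0 j)) (ydir_unit j) p2
    (fun w hw => (hr w hw j).2).
  have h3 := IH x2 p3.
  have E : x + ((Re (u 0 j))%:C *: xdir j + (Im (u 0 j))%:C *: ydir j +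
      \sum_(i <- s) ((Re (u 0 i))%:C *: xdir i + (Im (u 0 i))%:C *: ydir i))
    = x2 + \sum_(i <- s) ((Re (u 0 i))%:C *: xdir i + (Im (u 0 i))%:C *: ydir i).
    by rewrite /x2 /x1 !addrA.
  rewrite E; exact: (triangle3 _ _ _ _ _ _ _ _ _ _ _ h1 h2 h3).
have au u j : a u j <= 2 * enorm u.
  have := Re_le_normc (u 0 j); have := Im_le_normc (u 0 j).
  by have := normc_le_enorm u j; rewrite /a; lra.
have sau u : \sum_j a u j <= 2 * n.+1%:R * enorm u.
  apply: le_trans (ler_sum _ (fun j _ => au u j)) _.
  rewrite sumr_const card_ord -[leLHS]mulr_natl mulrA ler_wpM2r ?enorm_ge0//.
  by rewrite mulrC ler_pM2l// ler_nat.
(* Two points of the ball of radius [r'] differ by less than [2 * r'], and the path between them has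
   length at most [2 * n.+1%:R] times this, so it stays in the ball of radius [r]. *)
pose r' := r / (1 + 4 * n.+1%:R).
have q0 : 0 < 1 + 4 * n.+1%:R :> R by rewrite addr_gt0// mulr_gt0.
have r'0 : 0 < r' by rewrite divr_gt0.
exists r' => // x u xr ur.
have uu : enorm u < 2 * r'.
  have -> : u = (x + u - z) - (x - z) by rewrite opprB addrA subrK addrC addKr.
  by apply: le_lt_trans (enormD _ _) _; rewrite enormN; lra.
have h : enorm (x - z) + \sum_j a u j < r.
  have rE : r = r' + 2 * n.+1%:R * (2 * r') by rewrite /r'; field; rewrite gt_eqF.
  rewrite rE; apply: ltr_leD => //; apply: le_trans (sau u) _.
  by apply: ler_wpM2l; exact: ltW.
have := path _ _ _ h; rewrite -row_decomposition => H; apply: le_trans H _.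
rewrite /e' mulrAC ler_pdivrMr// -mulrA ler_pM2l// mulrC.
exact: sau.
Qed.

End StrictDifferentiability.

Section ExteriorCone.
Context {R : realType} {n : nat}.
Local Notation Cn := 'rV[R[i]]_n.
Implicit Types (x y z w d u p q pq : Cn) (D : set Cn).

Lemma hdot_mulmx u w : hdot u w = (u *m map_mx Num.conj w^T) 0 0.
Proof. by rewrite mxE; apply: eq_bigr => j _; rewrite !mxE. Qed.

Lemma hdot_adjoint (A : 'M[R[i]]_n) u w :
  hdot (u *m A) w = hdot u (w *m map_mx Num.conj A^T).
Proof.
rewrite !hdot_mulmx -mulmxA; congr ((_ *m _) 0 0).
rewrite trmx_mul map_mxM; congr (_ *m _).
by apply/matrixP => i j; rewrite !mxE /= conjCK.
Qed.

Lemma enorm_unitary (A : 'M[R[i]]_n) u : A \is unitarymx ->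
  enorm (u *m A) = enorm u.
Proof.
move=> /unitarymxP AA; rewrite /enorm hdot_adjoint -mulmxA.
by rewrite [_ *m map_mx _ _]AA mulmx1.
Qed.

Lemma drop_reD (j : 'I_n) x y : drop_re j (x + y) = drop_re j x + drop_re j y.
Proof.
apply/rowP => k; rewrite !mxE; case: eqP => // _.
by apply: complex_ext; rewrite ?cReD ?cImD /= ?addr0// mxE cImD.
Qed.

Lemma enorm_drop_re (j : 'I_n) x : enorm (drop_re j x) <= enorm x.
Proof.
rewrite -(@ler_pXn2r _ 2)// ?nnegrE ?enorm_ge0// !enorm_sqr_sum.
apply: ler_sum => k _; rewrite mxE; case: eqP => // ->.
by rewrite !normc_sqr /= expr0n add0r lerDr sqr_ge0.
Qed.

Lemma drop_reB (j : 'I_n) x y : drop_re j x - drop_re j y = drop_re j (x - y).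
Proof. by apply/eqP; rewrite subr_eq -drop_reD subrK. Qed.

Lemma drop_re_xdir (j : 'I_n) : drop_re j (- xdir j) = 0 :> Cn.
Proof.
apply/rowP => k; rewrite !mxE; case: eqP => [_|_].
  by rewrite !eqxx; apply: complex_ext => //; rewrite [LHS]cImN oppr0.
by rewrite andbF oppr0.
Qed.

(** The defining function, [phi] minus the dropped real coordinate, grows along directions making a
    positive angle with its tangent plane, up to the strict differentiability error. The axis [nu]
    is its normalised gradient at [p]. *)
Lemma exterior_cone D p (e : R) : 0 < e -> C1_boundary_near D p ->
  exists (nu : Cn) (r : R), [/\ enorm nu = 1, 0 < r & forall w u,
    enorm (w - p) < r -> enorm (w + u - p) < r -> ~ D w ->
    e * enorm u <= Re (hdot u nu) -> ~ D (w + u)].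
Proof.
move=> e0 [A [b [j [phi [uA /C1_strictly_differentiable C1 /nbhs_enormP[r1 r10 hr1]]]]]].
have [r2 r20 hr2] := C1 e e0.
set P0 := drop_re j (p *m A + b) in hr2.
pose px k := partial (xdir k) phi P0; pose py k := partial (ydir k) phi P0.
(* [G] is the gradient of the defining function in the unitary coordinates, with [-1] for the
   dropped real coordinate; [N] carries it back to the original ones. *)
pose G : Cn := \row_k if k == j then -1 +i* py k else px k +i* py k.
pose N : Cn := G *m map_mx Num.conj A^T.
have NG u : Re (hdot u N) = \sum_k (Re (drop_re j (u *m A) 0 k) * px k
    + Im (drop_re j (u *m A) 0 k) * py k) - Re ((u *m A) 0 j).
  rewrite -hdot_adjoint; move: (u *m A) => v.
  rewrite /hdot cRe_sum (bigD1 j)//= [in RHS](bigD1 j)//=.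
  rewrite !mxE eqxx cReM cReJ cImJ /= mul0r add0r.
  rewrite [RHS]addrAC; congr (_ + _); first by ring.
  apply: eq_bigr => k kj; rewrite !mxE (negbTE kj) cReM cReJ cImJ /=.
  by ring.
(* Tested on the unit vector sent to [- xdir j]. Since [enorm N] is at least 1, the cone condition
   for the normalised axis implies the one for [N]. *)
have N1 : 1 <= enorm N.
  pose u : Cn := - xdir j *m map_mx Num.conj A^T.
  have uAE : u *m A = - xdir j.
    have /mulmx1C AA : A *m map_mx Num.conj A^T = 1%:M by exact/unitarymxP.
    by rewrite /u -mulmxA AA mulmx1.
  have nu1 : enorm u = 1 by rewrite -(enorm_unitary _ _ uA) uAE enormN xdir_unit.
  have : Re (hdot u N) = 1.
    rewrite NG uAE big1 => [|k _].
      by rewrite !mxE !eqxx /= sub0r opprK.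
    rewrite drop_re_xdir; move: (px k) (py k) => s t.
    by rewrite (mxE _ (fun _ _ => _)) /= !mul0r addr0.
  by move=> E; have := Re_hdot_le u N; rewrite E nu1 mul1r normr1.
have N0 : 0 < enorm N by lra.
have nN : enorm ((enorm N)^-1%:C *: N) = 1.
  by rewrite enormZ normc_real ger0_norm ?invr_ge0 ?enorm_ge0// mulVf ?gt_eqF.
exists ((enorm N)^-1%:C *: N), (Num.min r1 r2).
split; [exact: nN|by rewrite lt_min r10 r20|move=> w u].
rewrite !lt_min => /andP[w1 w2] /andP[u1 u2] Dw hu Dwu; apply: Dw.
apply/(hr1 _ w1); move/(hr1 _ u1): Dwu.
have E : (w + u) *m A + b = (w *m A + b) + u *m A by rewrite mulmxDl addrAC.
rewrite E drop_reD.
have bnd x : enorm (drop_re j (x *m A + b) - P0) <= enorm (x - p).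
  rewrite /P0 drop_reB opprD addrACA subrr addr0 -mulmxBl.
  by apply: le_trans (enorm_drop_re _ _) _; rewrite enorm_unitary.
have := hr2 (drop_re j (w *m A + b)) (drop_re j (u *m A))
  (le_lt_trans (bnd w) w2).
rewrite -drop_reD -E => /(_ (le_lt_trans (bnd _) u2)).
rewrite E drop_reD.
have NE := NG u; rewrite /px /py in NE.
set F := phi (_ + _); set S := \sum_k _ in NE *.
have hle : e * enorm (drop_re j (u *m A)) <= e * enorm u.
  rewrite ler_pM2l// -(enorm_unitary _ u uA); exact: enorm_drop_re.
have : e * enorm u <= Re (hdot u N).
  apply: (le_trans hu); rewrite hdotZr conjC_realc cReZ.
  have [h0|h0] := leP 0 (Re (hdot u N)).
    by rewrite ler_piMl// invf_le1.
  have iN : 0 < (enorm N)^-1 by rewrite invr_gt0.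
  have := le_trans (mulr_ge0 (ltW e0) (enorm_ge0 u)) hu.
  by rewrite hdotZr conjC_realc cReZ (pmulr_rge0 _ iN) leNgt h0.
rewrite NE {NE}; move: hle; move: (enorm u) (enorm (drop_re j _)) => U V hle hS.
have mD (x y : Cn) : (x + y) 0 j = x 0 j + y 0 j by rewrite mxE.
rewrite (mD (w *m A + b)) cReD ler_norml => /andP[h _]; move: hS h hle.
move: (Re ((u *m A) 0 j)) (Re ((w *m A + b) 0 j)) (phi _) F S => a c f F S.
by lra.
Qed.

End ExteriorCone.

(** * Numerical margins for the angle between the normal and the cone axis *)

Section RealMargins.
Context {R : realType}.

Lemma unit_le1 (c b : R) : c ^+ 2 + b ^+ 2 <= 1 -> c <= 1.
Proof. by have := sqr_ge0 b; nra. Qed.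

Lemma cone_margin (t c U : R) : 0 < t -> c <= 1 -> U <= 2 * t ->
  100^-1 * U <= t * (1 - 98 / 100 * c).
Proof. by move=> t0 c1 U2; have := mulr_ge0 (ltW t0) (_ : 0 <= 1 - c); lra. Qed.

Lemma normal_margin (d t c U : R) : 0 < d -> 0 < t -> t <= d / 200 ->
  U ^+ 2 <= (2 * t) ^+ 2 ->
  d ^+ 2 <= d ^+ 2 + 2 * (d * (t * (c - 98 / 100))) + U ^+ 2 -> 97 / 100 <= c.
Proof.
move=> d0 t0 td U2 h.
have : 0 <= t * (2 * d * (c - 98 / 100) + 4 * t) by lra.
rewrite pmulr_rge0// => h3.
have : 0 <= d * (2 * (c - 98 / 100) + 4 / 200) by lra.
by rewrite pmulr_rge0//; lra.
Qed.

Lemma im_margin (c b : R) : 97 / 100 <= c -> c ^+ 2 + b ^+ 2 <= 1 -> `|b| <= 1 / 4.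
Proof. by move=> c97 cb; rewrite ler_norml; apply/andP; split; nra. Qed.

Lemma sector_margin (a y b c X : R) : 0 <= a -> `|y| <= a -> `|b| <= 1 / 4 ->
  97 / 100 <= c -> X <= 2 * a -> 100^-1 * X <= a * c - y * b.
Proof.
move=> a0 ya b4 c97 X2; have h : y * b <= a / 4.
  apply: le_trans (ler_norm _) _; rewrite normrM -[leRHS]/(a * 4^-1).
  by apply: ler_pM => //; lra.
by nra.
Qed.

End RealMargins.

Section NearestPoint.
Context {R : realType} {n : nat}.
Local Notation Cn := 'rV[R[i]]_n.
Implicit Types (x y z w d u p q pq : Cn) (D A : set Cn).

Lemma eucl_dist_ge0 z A : (0 <= eucl_dist z A)%E.
Proof. by apply: le_ereal_inf_tmp => _ [w _ <-]; rewrite lee_fin enorm_ge0. Qed.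

Lemma eucl_dist_le z A w : A w -> (eucl_dist z A <= (enorm (z - w))%:E)%E.
Proof. by move=> Aw; apply: ereal_inf_lbound; exists w. Qed.

Lemma delta_le D q b : boundary D b -> delta D q <= enorm (q - b).
Proof.
move=> Db; have h := eucl_dist_le q _ _ Db; have := eucl_dist_ge0 q (boundary D).
by rewrite /delta; case: (eucl_dist q _) h => //= x; rewrite !lee_fin.
Qed.

Lemma delta_star_ge0_le1 D q pq : 0 <= delta_star D q pq <= 1.
Proof.
rewrite /delta_star; set E := eucl_dist _ _.
have : (0 <= E)%E by exact: eucl_dist_ge0.
case: E => [x| |] //=; last by rewrite min_l ?leey//= ler01 lexx.
rewrite lee_fin -EFin_min/= => x0; rewrite le_min ler01 x0/= ge_min.
by rewrite lexx.
Qed.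

Lemma delta_star_le D q pq w : D w -> hdot (w - qstar q pq) (pq - q) = 0 ->
  delta_star D q pq <= enorm (w - qstar q pq).
Proof.
move=> Dw h0; rewrite enormB /delta_star.
have /(eucl_dist_le (qstar q pq)) : (closure D `&`
    orth_hyperplane (qstar q pq) (complex_line q pq)) w.
  split; first exact: subset_closure.
  move=> _ _ [a _ <-] [b _ <-].
  have -> : q + a *: (pq - q) - (q + b *: (pq - q)) = (a - b) *: (pq - q).
    by rewrite opprD addrACA subrr add0r -scalerBl.
  by rewrite hdotZr h0 mulr0.
have := eucl_dist_ge0 (qstar q pq) (closure D `&`
    orth_hyperplane (qstar q pq) (complex_line q pq)).
case: (eucl_dist _ _) => [x| |] //= _; rewrite lee_fin -EFin_min/= => h.
by rewrite ge_min h orbT.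
Qed.

Lemma open_boundary_notin D b : open D -> boundary D b -> ~ D b.
Proof. by move=> /interior_id oD [_]; rewrite oD. Qed.

(** The first exit point works: it is outside [D] because [D] is open, and slightly earlier points
    are in [D]. *)
Lemma segment_boundary D q z : open D -> D q -> ~ D z ->
  exists t : R, [/\ 0 <= t, t <= 1 & boundary D (q + t%:C *: (z - q))].
Proof.
move=> oD Dq nDz; pose g (t : R) : Cn := q + t%:C *: (z - q).
pose A := [set t : R | 0 <= t /\ ~ D (g t)].
have A1 : A 1 by split; [exact: ler01|rewrite /g scale1r addrC subrK].
have hA : has_inf A by split; [exists 1|exists 0 => t []].
pose t0 := inf A.
have t00 : 0 <= t0 by apply: lb_le_inf; [exists 1|move=> t []].
have t01 : t0 <= 1 by apply: ge_inf => //; exists 0 => t [].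
have gd s t : enorm (g s - g t) = `|s - t| * enorm (z - q).
  rewrite /g opprD addrACA subrr add0r -scalerBl enormZ -normc_real.
  by rewrite rmorphB.
have lip (r : R) : 0 < r ->
    exists2 e, 0 < e & forall s t, `|s - t| < e -> enorm (g s - g t) < r.
  move=> r0; have K0 : 0 < enorm (z - q) + 1 by rewrite ltr_wpDl ?enorm_ge0.
  exists (r / (enorm (z - q) + 1)); first by rewrite divr_gt0.
  move=> s t; rewrite ltr_pdivlMr// gd => h; apply: le_lt_trans h.
  by rewrite ler_wpM2l// lerDl.
have nDt0 : ~ D (g t0).
  move=> Dt; have /nbhs_enormP[r r0 hr] := open_nbhs_nbhs (conj oD Dt).
  have [e e0 he] := lip r r0.
  have [a Aa at0] := inf_adherent e0 hA.
  have ta : t0 <= a by apply: ge_inf => //; exists 0 => t [].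
  case: Aa => _; apply; apply: hr; apply: he.
  by rewrite ger0_norm ?subr_ge0// ltrBlDl.
exists t0; split=> //; split; last by move/interior_subset.
move=> B /nbhs_enormP[r r0 hr]; have [e e0 he] := lip r r0.
have t0p : 0 < t0.
  rewrite lt_def t00 andbT; apply/eqP => t0E; apply: nDt0.
  by rewrite t0E /g scale0r addr0.
pose s := Num.max 0 (t0 - e / 2).
have s0 : 0 <= s by rewrite le_max lexx.
have st : s < t0 by rewrite gt_max t0p; lra.
have se : t0 - e / 2 <= s by rewrite le_max lexx orbT.
exists (g s); split.
  apply: contrapT => nD; have : A s by split.
  move=> As; have : t0 <= s by apply: ge_inf => //; exists 0 => t [].
  by rewrite leNgt st.
by apply: hr; apply: he; rewrite ler0_norm ?subr_le0 ?(ltW st)//; lra.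
Qed.

Lemma ball_delta D q z : open D -> D q -> enorm (z - q) < delta D q -> D z.
Proof.
move=> oD Dq zd; apply: contrapT => nDz.
have [t [t0 t1 /(delta_le _ q)]] := segment_boundary D q z oD Dq nDz.
rewrite enormB addrC addKr enormZ normc_real ger0_norm// => h.
by have := lt_le_trans zd h; rewrite ltNge ler_piMl ?enorm_ge0.
Qed.

Lemma hdot_unit_le u w : enorm u = 1 -> enorm w = 1 ->
  Re (hdot u w) ^+ 2 + Im (hdot u w) ^+ 2 <= 1.
Proof.
move=> u1 w1; have := hdot_CS u w; rewrite u1 w1 mulr1 -normc_sqr => h.
by rewrite expr_le1// normc_ge0.
Qed.

Lemma projection_pythagoras z u : enorm u = 1 ->
  hdot (z - hdot z u *: u) u = 0 /\ enorm (z - hdot z u *: u) <= enorm z.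
Proof.
move=> u1; have h : hdot (z - hdot z u *: u) u = 0.
  by rewrite hdotBl hdotZl hdotxx u1 expr1n mulr1 subrr.
split=> //; rewrite -(@ler_pXn2r _ 2)// ?nnegrE ?enorm_ge0//.
have -> : enorm z ^+ 2 = enorm ((z - hdot z u *: u) + hdot z u *: u) ^+ 2.
  by rewrite subrK.
by rewrite enormD_sqr hdotZr h !mulr0 addr0 lerDl sqr_ge0.
Qed.

Definition unit_normal q pq : Cn := ((enorm (pq - q))^-1)%:C *: (pq - q).

Lemma unit_normalE q pq : pq != q ->
  enorm (unit_normal q pq) = 1 /\
  pq - q = (enorm (pq - q))%:C *: unit_normal q pq.
Proof.
move=> pqq; have d0 : 0 < enorm (pq - q) by rewrite enorm_gt0 subr_eq0.
rewrite /unit_normal; split.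
  by rewrite enormZ normc_real ger0_norm ?invr_ge0 ?enorm_ge0// mulVf ?gt_eqF.
by rewrite scalerA -rmorphM /= mulfV ?gt_eqF// scale1r.
Qed.

(* The ball of radius [delta D q] around [q] lies in [D], and the exterior cone
   at [pq] does not meet [D]: this forces the directions of [nu] and of the
   axis of the cone to be close. *)
Lemma domain_below_cone D p : open D -> boundary D p -> C1_boundary_near D p ->
  exists2 r : R, 0 < r & forall q pq z, D q -> enorm (q - p) < r ->
    boundary D pq -> enorm (q - pq) = delta D q -> D z ->
    enorm (z - q) < r -> enorm (z - q) < delta_star D q pq ->
    Re (hdot (z - q) (unit_normal q pq)) - 2 * delta D q
      < `|Im (hdot (z - q) (unit_normal q pq))|.
Proof.
move=> oD Dp C1; have [e [r [e1 r0 cone]]] := exterior_cone D p (100^-1) ltac:(by lra) C1.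
exists (r / 8); first by rewrite divr_gt0.
move=> q pq z Dq qp Dpq qpq Dz zq zds.
have pqq : pq != q by apply: contra_notN (open_boundary_notin _ _ oD Dpq) => /eqP->.
have [] := unit_normalE q pq pqq; set nu := unit_normal q pq => nu1.
rewrite enormB qpq; set d := delta D q; set h := hdot (z - q) nu => pqE.
have d0 : 0 < d by rewrite /d -qpq enorm_gt0 subr_eq0 eq_sym.
have dr : d < r / 8 by apply: le_lt_trans qp; exact: delta_le.
have pqp : enorm (pq - p) < r / 4.
  have := enorm_dist pq q p; rewrite (enormB pq q) qpq -/d.
  by move: dr qp; clear -n; lra.
pose c := Re (hdot nu e); pose b := Im (hdot nu e).
have cb : c ^+ 2 + b ^+ 2 <= 1 by exact: hdot_unit_le.
have c97 : 97 / 100 <= c.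
  pose t := Num.min (d / 200) (r / 8).
  have t0 : 0 < t by rewrite lt_min (divr_gt0 d0)// (divr_gt0 r0).
  have td : t <= d / 200 by rewrite ge_min lexx.
  have tr : t <= r / 8 by rewrite ge_min lexx orbT.
  (* The test vector [u] leans towards the cone axis [e] and backwards along [nu]. It lies in the
     cone of slope 1/100 even if [c = 1], so [pq + u] is at distance at least [d] from [q];
     expanding the square gives [c >= s - 2 * t / d], hence [97 / 100] as [t <= d / 200]. *)
  pose s : R := 98 / 100.
  pose u := t%:C *: (e - s%:C *: nu).
  have uu : enorm u <= 2 * t.
    rewrite enormZ normc_real gtr0_norm// mulrC ler_pM2r//.
    apply: le_trans (enormD _ _) _; rewrite enormN enormZ normc_real e1 nu1.
    by rewrite ger0_norm /s; clear -n; lra.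
  have ue : Re (hdot u e) = t * (1 - s * c).
    by rewrite hdotZl cReZ hdotBl hdotZl hdotxx e1 expr1n cReD cReN cReZ.
  have un : Re (hdot nu u) = t * (c - s).
    rewrite hdotZr conjC_realc cReZ hdotBr hdotZr conjC_realc hdotxx nu1.
    by rewrite expr1n mulr1 cReD cReN.
  have c1 : c <= 1 := unit_le1 _ _ cb.
  have nDu : ~ D (pq + u).
    apply: cone; [| |exact: open_boundary_notin|].
    - by move: pqp r0; clear -n; lra.
    - apply: le_lt_trans (enormD_shift _ _ _) _.
      by move: pqp uu tr r0; clear -n; lra.
    rewrite ue; exact: cone_margin _ _ _ t0 c1 uu.
  have : d <= enorm (pq + u - q).
    by rewrite leNgt; apply/negP => /(ball_delta D q _ oD Dq).
  rewrite addrAC pqE => du.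
  have : d ^+ 2 <= enorm (d%:C *: nu + u) ^+ 2.
    by rewrite ler_pXn2r ?nnegrE ?enorm_ge0//; exact: ltW.
  rewrite enormD_sqr enormZ normc_real nu1 hdotZl cReZ un mulr1 gtr0_norm//.
  have U2 : enorm u ^+ 2 <= (2 * t) ^+ 2.
    by rewrite ler_pXn2r ?nnegrE ?enorm_ge0// mulr_ge0// ltW.
  exact: normal_margin _ _ _ _ d0 t0 td U2.
have b25 : `|b| <= 1 / 4 := im_margin _ _ c97 cb.
rewrite ltNge; apply/negP => hh.
have [z'0 z'le] := projection_pythagoras (z - q) nu nu1.
rewrite -/h in z'0 z'le; set z' := z - q - _ in z'0 z'le.
have qsE : qstar q pq = q + (2 * d)%:C *: nu.
  have -> : (2 * d)%:C *: nu = 2%:R *: (pq - q).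
    by rewrite pqE scalerA rmorphM rmorph_nat.
  by rewrite /qstar; apply/rowP => k; rewrite !mxE; ring.
(* [w] is the point of the orthogonal hyperplane with the same tangential part as [z], too close to
   [qstar] to be in [D]. If the claim fails, [z - w = (h - 2 d) nu] lies in the cone at [w], so [z]
   is not in [D] either. *)
pose w := qstar q pq + z'.
have zE : z = w + (h - (2 * d)%:C) *: nu.
  by rewrite /w qsE /z'; apply/rowP => k; rewrite !mxE; ring.
have wq : w - qstar q pq = z' by rewrite /w addrC addKr.
have nDw : ~ D w.
  move=> Dw; have := delta_star_le D q pq w Dw; rewrite wq pqE hdotZr z'0 mulr0.
  by move=> /(_ erefl) /le_trans/(_ z'le); rewrite leNgt zds.
apply: (cone w ((h - (2 * d)%:C) *: nu) _ _ nDw _); last by rewrite -zE.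
- rewrite /w qsE; apply: le_lt_trans (enormD_shift _ _ _) _.
  apply: (@le_lt_trans _ _ (enorm (q - p) + 2 * d + enorm z')).
    rewrite lerD2r; apply: le_trans (enormD_shift _ _ _) _.
    rewrite enormZ normc_real nu1 mulr1 ger0_norm//.
    by apply: mulr_ge0 => //; exact: ltW.
  by move: r0 qp dr zq z'le; clear -n; lra.
- by rewrite -zE; have := enorm_dist z q p; move: qp zq r0; clear -n; lra.
rewrite enormZ nu1 mulr1 hdotZl cReM -/c -/b cReD cImD cReN cImN /= oppr0 addr0.
have := le_normcD ((Re h - 2 * d)%:C) ('i%C * (Im h)%:C).
rewrite Normc.normcM !normc_real.
have -> : (Re h - 2 * d)%:C + 'i%C * (Im h)%:C = h - (2 * d)%:C.
  by apply: complex_ext; rewrite ?cReD ?cImD ?cReM ?cImM ?cReN ?cImN /=; ring.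
have -> : normc 'i%C = 1 :> R by rewrite /= expr0n expr1n add0r sqrtr1.
rewrite mul1r; have := le_trans (normr_ge0 _) hh => a0.
rewrite (ger0_norm a0) => hX.
have h2 : normc (h - (2 * d)%:C) <= 2 * (Re h - 2 * d).
  by apply: le_trans hX _; move: hh; clear -n; lra.
exact: sector_margin _ _ _ _ _ a0 hh b25 c97 h2.
Qed.

End NearestPoint.

(** * Competitors for the Sibony metric *)

Section RealFacts.
Context {R : realType}.

Lemma continuous_norm_powR (k : R) : 0 < k -> continuous (fun x : R => `|x| `^ k).
Proof.
move=> k0 x; have [->|x0] := eqVneq x 0; last first.
  have h1 : {for x, continuous (fun y : R => `|y|)} by exact: norm_continuous.
  have h2 : {for `|x|, continuous (fun y : R => y `^ k)}.
    apply/differentiable_continuous/derivable1_diffP/derivable_powR.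
    by rewrite in_itv /= andbT normr_gt0.
  exact: (continuous_comp h1 h2).
apply/cvgrPdist_lt => e e0; rewrite normr0 powR0 ?gt_eqF//.
exists (e `^ k^-1); first by rewrite /= powR_gt0.
move=> y; rewrite /= !sub0r !normrN => ye.
rewrite (ger0_norm (powR_ge0 _ _)) -[ltRHS](powRr1 (ltW e0)).
rewrite -(mulVf (lt0r_neq0 k0)) powRrM.
by apply: (gt0_ltr_powR k0) => //; rewrite nnegrE ?normr_ge0 ?powR_ge0.
Qed.

Lemma ge1_powR (x k : R) : 1 <= x -> 0 <= k -> 1 <= x `^ k.
Proof. by move=> x1 k0; rewrite -(powRr0 x) ler_powR. Qed.

Lemma le_powR (x y k : R) : 0 <= k -> 0 <= x -> x <= y -> x `^ k <= y `^ k.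
Proof.
move=> k0 x0 xy; apply: ge0_ler_powR => //; rewrite nnegrE//.
exact: le_trans xy.
Qed.

(** The excluded sector has its vertex at [2 d] and contains the pole [3 d] on its axis: either
    [a <= 5 / 2 * d], or [b] has modulus above [d / 2]. *)
Lemma sector_far_from_pole (d a b : R) : 0 < d -> a - 2 * d < `|b| ->
  (d / 2) ^+ 2 <= (a - 3 * d) ^+ 2 + b ^+ 2.
Proof.
move=> d0 h; have [ad|ad] := leP a (5 / 2 * d).
  have h1 : d / 2 <= 3 * d - a by lra.
  have h2 : (d / 2) ^+ 2 <= (3 * d - a) ^+ 2.
    by apply: lerXn2r => //; rewrite nnegrE; lra.
  have := sqr_ge0 b; have -> : (a - 3 * d) ^+ 2 = (3 * d - a) ^+ 2 by ring.
  lra.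
have h1 : d / 2 <= `|b| by lra.
have h2 : (d / 2) ^+ 2 <= `|b| ^+ 2.
  by apply: lerXn2r => //; rewrite nnegrE//; lra.
by rewrite real_normK ?num_real// in h2; have := sqr_ge0 (a - 3 * d); lra.
Qed.

End RealFacts.

Section SibonyCandidate.
Context {R : realType} {n : nat}.
Local Notation Cn := 'rV[R[i]]_n.
Implicit Types (z w q X nu : Cn) (D : set Cn).

Lemma continuous_normc_hdot q nu (c : R[i]) : enorm nu = 1 ->
  continuous (fun z => normc (hdot (z - q) nu - c)).
Proof.
move=> nu1; apply: (lipschitz_enorm_continuous _ 1) => z w; rewrite mul1r.
have h : normc (hdot (z - w) nu) <= enorm (z - w).
  by have := hdot_CS (z - w) nu; rewrite nu1 mulr1.
have E : hdot (z - w) nu = (hdot (z - q) nu - c) - (hdot (w - q) nu - c).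
  by rewrite !hdotBl; ring.
have h1 := le_normcD (hdot (z - w) nu) (hdot (w - q) nu - c).
have h2 := le_normcD (- hdot (z - w) nu) (hdot (z - q) nu - c).
rewrite {1}E subrK in h1; rewrite {1}E opprB subrK normcN in h2.
by rewrite ler_norml; apply/andP; split; lra.
Qed.

Lemma continuous_enormB q : continuous (fun z => enorm (z - q)).
Proof.
apply: (lipschitz_enorm_continuous _ 1) => z w; rewrite mul1r.
by apply: le_trans (enormB_ler _ _) _; rewrite opprB addrA subrK.
Qed.

Lemma near_complex_line (P : set Cn) z w : (\forall y \near z, P y) ->
  exists2 r : R, 0 < r & forall x : R[i], normc (x - 0) < r -> P (z + x *: w).
Proof.
move=> /nbhs_enormP[r r0 hr]; have w0 : 0 < enorm w + 1 by rewrite ltr_wpDl ?enorm_ge0.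
exists (r / (enorm w + 1)); first by rewrite divr_gt0.
move=> x; rewrite subr0 ltr_pdivlMr// => h; apply: hr.
rewrite addrC addKr enormZ; apply: le_lt_trans h.
by rewrite ler_wpM2l ?normc_ge0// lerDl.
Qed.

Lemma continuous_gt0_near (f : Cn -> R) z : {for z, continuous f} -> 0 < f z ->
  \forall y \near z, 0 < f y.
Proof.
move=> /continuous_enormP cf fz; have [r r0 hr] := cf _ fz.
apply/nbhs_enormP; exists r => // w /hr; rewrite ltr_norml => /andP[_].
by rewrite ltrBlDl ltrDr.
Qed.

Lemma continuous_lt_near (f g : Cn -> R) z : {for z, continuous f} ->
  {for z, continuous g} -> f z < g z -> \forall y \near z, f y < g y.
Proof.
move=> cf cg fg; have : \forall y \near z, 0 < g y - f y.
  by apply: (continuous_gt0_near (fun y => g y - f y));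
    [exact: (continuousB cg cf)|rewrite subr_gt0].
by apply: filterS => y; rewrite subr_gt0.
Qed.

Lemma Sibony_ge D z X v (s : R) : Sibony_class D z v ->
  Levi v z X = (s ^+ 2)%:C -> 0 <= s -> (s%:E <= Sibony D z X)%E.
Proof.
move=> Sv Lv s0; apply: ereal_sup_ubound; exists v => //.
by rewrite Lv /= sqrtr_sqr ger0_norm.
Qed.

Lemma Sibony_norm D q X (M : R) : 0 < M ->
  (forall z, D z -> enorm (z - q) < M) ->
  ((M^-1 * enorm X)%:E <= Sibony D q X)%E.
Proof.
move=> M0 DM; pose v z := enorm (z - q) ^+ 2 * M ^- 2.
have M2 : 0 < M ^- 2 by rewrite invr_gt0 exprn_gt0.
have [Cv Lv] : Ck_near 2 v q /\ Levi v q X = (enorm X ^+ 2 * M ^- 2)%:C.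
  apply: (Levi_quadratic id 1 q _ _ (fun=> M ^- 2)) => //.
  - by move=> z; rewrite mul1r.
  - exact: Ck_near_cst.
  - exact: near_all.
have v01 w : D w -> 0 <= v w < 1.
  move=> /DM wM; rewrite mulr_ge0 ?sqr_ge0 ?ltW//=.
  by rewrite ltr_pdivrMr ?exprn_gt0// mul1r ltr_pXn2r// nnegrE ?enorm_ge0 ?ltW.
have c1 z : {for z, continuous (fun z => enorm (z - q))}.
  exact: continuous_enormB.
apply: (Sibony_ge _ _ _ v).
- split=> //; first by rewrite /v subrr enorm0 expr0n mul0r.
  apply: plurisubharmonic_lne => // [w _|z w _ vz].
    exact: (continuousM (continuousM (c1 w) (c1 w)) (@cst_continuous _ _ _ _)).
  have zq : 0 < enorm (z - q).
    rewrite enorm_gt0; apply: contraTneq vz => h.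
    by rewrite /v h enorm0 expr0n mul0r ltxx.
  have lnv y : 0 < enorm (y - q) ->
      ln (v y) = ln (enorm (y - q) ^+ 2) + ln (M ^- 2).
    by move=> yq; apply: lnM; rewrite posrE// exprn_gt0.
  apply: (locally_submean_support _
    (fun x => ln (enorm (z - q + x *: w) ^+ 2) + ln (M ^- 2))).
  + by rewrite scale0r !addr0 lnv.
  + have [r r0 hr] := near_complex_line _ z w (continuous_gt0_near _ _ (c1 z) zq).
    by exists r => // x /hr xq; rewrite lnv// addrAC.
  apply: locally_submeanD; last exact: locally_submean_cst.
  by apply: locally_submean_ln_enorm; rewrite -enorm_gt0.
- by rewrite Lv; congr (_%:C); rewrite exprMn exprVn mulrC.
- by rewrite mulr_ge0 ?invr_ge0 ?enorm_ge0 ?ltW.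
Qed.

End SibonyCandidate.

(** * The glued competitor with large Levi form in the normal direction *)

Section Barrier.
Context {R : realType} {n : nat}.
Local Notation Cn := 'rV[R[i]]_n.
Implicit Types (z w X : Cn).

Set Implicit Arguments.

Variables (D : set Cn) (q nu : Cn) (d eps M : R).
Hypotheses (oD : open D) (nu1 : enorm nu = 1) (d0 : 0 < d) (d1 : d < 1).
Hypotheses (e0 : 0 < eps) (e1 : eps <= 1) (M1 : 1 <= M).
Hypothesis DM : forall z, D z -> enorm (z - q) <= M.
Hypothesis sector : forall z, D z -> enorm (z - q) < eps ->
  Re (hdot (z - q) nu) - 2 * d < `|Im (hdot (z - q) nu)|.

(* [vin] has the large Levi form wanted at [q], but it is controlled only on
   [G], where [sector] keeps [h] away from the pole [3 * d]; [vout] is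
   log-plurisubharmonic everywhere. The factor [(`|h| / d) `^ k] makes [vout]
   negligible against [vin] near [q], so that the maximum of both is smooth
   there, and the choice of [k] gives [(M / d) `^ k = expR 1], so that this
   factor costs only a constant in the upper bound of [vout] on [D]. *)
Let h z := hdot (z - q) nu.
(** A single linear map whose squared norm contains both numerator terms of [vin], so that [ln N] is
    plurisubharmonic and [Levi_quadratic] applies. *)
Let L (y : Cn) : Cn := d%:C *: y + hdot y nu *: nu.
Let dd z := normc (h z - (3 * d)%:C) ^+ 2.
Let N z := enorm (L (z - q)) ^+ 2.
(** Bound of [N / dd] on [G]: with [dd >= (d / 2) ^+ 2] the isotropic part gives [4 * M ^+ 2], and
    the normal part gives [3 * 7 ^+ 2]. *)
Let T := 4 * M ^+ 2 + 147.
Let k := (ln (M / d))^-1.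
(** Normalisation: the first term makes [vout] less than 1 on [D], the second makes [vin] less than
    1 on [G]. *)
Let K := 4 * T * expR 1 * M ^+ 2 + T.
Let W z := eps ^+ 2 / K * (dd z)^-1.
Let vin z := N z * W z.
Let vout z := 4 * T / K * (`|normc (h z) / d| `^ k * enorm (z - q) ^+ 2).
(** Each alternative keeps [h] away from [3 * d] on [D]. Outside [G] both [normc (h z)] and
    [enorm (z - q)] are large, as the comparison with [vout] requires. *)
Let G z := (normc (h z) < 3 / 2 * d) || (enorm (z - q) < eps).
Let v z := if G z then Num.max (vin z) (vout z) else vout z.

Let M0 : 0 < M. Proof. by apply: lt_le_trans M1. Qed.
Let M2 : 1 <= M ^+ 2. Proof. by rewrite expr_ge1// ltW. Qed.
Let T0 : 0 < T. Proof. by rewrite /T; move: M2; lra. Qed.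
Let eM : 0 < 4 * T * expR 1 * M ^+ 2.
Proof. by rewrite !mulr_gt0 ?expR_gt0 ?exprn_gt0. Qed.
Let K0 : 0 < K. Proof. by rewrite addr_gt0. Qed.
Let Md : 1 < M / d. Proof. by rewrite ltr_pdivlMr// mul1r (lt_le_trans d1). Qed.
Let k0 : 0 < k. Proof. by rewrite invr_gt0 ln_gt0. Qed.

Let normch_le z : normc (h z) <= enorm (z - q).
Proof. by have := hdot_CS (z - q) nu; rewrite nu1 mulr1. Qed.

Let ratio_ge0 z : 0 <= normc (h z) / d.
Proof. by rewrite divr_ge0 ?normc_ge0 ?ltW. Qed.

Let TK0 : 0 < 4 * T / K. Proof. by apply: divr_gt0 => //; apply: mulr_gt0. Qed.

Let eK0 : 0 < eps ^+ 2 / K. Proof. by apply: divr_gt0 => //; apply: exprn_gt0. Qed.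

Let vout_ge0 z : 0 <= vout z.
Proof.
apply: mulr_ge0; first exact: ltW.
by apply: mulr_ge0; [exact: powR_ge0|exact: sqr_ge0].
Qed.

Let linL : linear L.
Proof.
move=> a x y; rewrite /L hdotDl hdotZl scalerDr scalerDl !scalerA !scalerDr !scalerA.
by rewrite (mulrC a d%:C) addrACA.
Qed.

Let NE z : enorm (L z) ^+ 2 =
  d ^+ 2 * enorm z ^+ 2 + (2 * d + 1) * normc (hdot z nu) ^+ 2.
Proof.
rewrite /L enormD_sqr !enormZ normc_real nu1 mulr1 hdotZl hdotZr (mulrC _^*) mulcJ.
by rewrite -rmorphM /= exprMn real_normK ?num_real//; ring.
Qed.

Let LK z : enorm (L z) <= (d + 1) * enorm z.
Proof.
rewrite mulrDl mul1r; apply: le_trans (enormD _ _) _.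
rewrite !enormZ normc_real nu1 mulr1 gtr0_norm// lerD2l.
by have := hdot_CS z nu; rewrite nu1 mulr1.
Qed.

Let far_from_pole z : D z -> G z -> (d / 2) ^+ 2 <= dd z.
Proof.
move=> Dz; rewrite /dd normc_sqr !cReD !cImD !cReN !cImN /= oppr0 addr0.
case/orP => [hz|zq]; last exact: (sector_far_from_pole _ _ _ d0 (sector Dz zq)).
have Rh : Re (h z) <= normc (h z) := le_trans (ler_norm _) (Re_le_normc _).
apply: sector_far_from_pole => //.
by have := normr_ge0 (Im (h z)); move: hz Rh d0; lra.
Qed.

Let dd_gt0 z : D z -> G z -> 0 < dd z.
Proof.
by move=> Dz Gz; apply: lt_le_trans (far_from_pole Dz Gz); rewrite exprn_gt0 ?divr_gt0.
Qed.

Let ratio_le z : D z -> G z -> N z / dd z <= T.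
Proof.
move=> Dz Gz; have dd0 := dd_gt0 Dz Gz; have far := far_from_pole Dz Gz.
have p0 := normc_ge0 (h z - (3 * d)%:C).
have d2 : d / 2 <= normc (h z - (3 * d)%:C).
  by rewrite -(@ler_pXn2r _ 2)// ?nnegrE// divr_ge0 ?ltW.
(* The distance to the pole is at least [d / 2], so [3 * d] is at most six times this distance. *)
have h7 : normc (h z) <= 7 * normc (h z - (3 * d)%:C).
  have := le_normcD (h z - (3 * d)%:C) (3 * d)%:C.
  rewrite subrK normc_real (gtr0_norm (x := 3 * d)) ?mulr_gt0//.
  by move: d2; lra.
have h49 : normc (h z) ^+ 2 <= 49 * dd z.
  have -> : 49 * dd z = (7 * normc (h z - (3 * d)%:C)) ^+ 2 by rewrite /dd; ring.
  by rewrite lerXn2r ?nnegrE ?normc_ge0// mulr_ge0.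
have zM : enorm (z - q) ^+ 2 <= M ^+ 2.
  by rewrite lerXn2r ?nnegrE ?enorm_ge0 ?DM// ltW.
rewrite ler_pdivrMr// /N NE -/(h z) /T.
have A1 : d ^+ 2 * enorm (z - q) ^+ 2 <= 4 * dd z * M ^+ 2.
  apply: ler_pM => //; try exact: sqr_ge0.
  by move: far; rewrite expr_div_n; lra.
have A2 : (2 * d + 1) * normc (h z) ^+ 2 <= 3 * (49 * dd z).
  by apply: ler_pM => //; rewrite ?sqr_ge0//; move: d0 d1; lra.
by move: A1 A2; lra.
Qed.

Let vin_le z : D z -> G z -> vin z <= eps ^+ 2 * T / K.
Proof.
move=> Dz Gz.
have -> : vin z = eps ^+ 2 / K * (N z / dd z) by rewrite /vin /W mulrCA.
have -> : eps ^+ 2 * T / K = eps ^+ 2 / K * T by rewrite mulrAC.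
by apply: ler_wpM2l; [exact: ltW|exact: ratio_le].
Qed.

(** The coefficient 4 in [vout] compensates the square of [eps / 2]. *)
Let vin_le_vout z : D z -> G z -> d <= normc (h z) -> eps / 2 <= enorm (z - q) ->
  vin z <= vout z.
Proof.
move=> Dz Gz dh ez; apply: le_trans (vin_le Dz Gz) _.
have r1 : 1 <= `|normc (h z) / d| `^ k.
  apply: ge1_powR; last exact: ltW.
  by rewrite ger0_norm ?ratio_ge0// ler_pdivlMr// mul1r.
have ez2 : (eps / 2) ^+ 2 <= enorm (z - q) ^+ 2.
  by rewrite lerXn2r ?nnegrE ?enorm_ge0// divr_ge0 ?ltW.
have E : eps ^+ 2 * T / K = 4 * T / K * (1 * (eps / 2) ^+ 2) by field; rewrite gt_eqF.
rewrite E; apply: ler_pM => //.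
- by rewrite divr_ge0 ?mulr_ge0 ?ltW.
- by rewrite mul1r sqr_ge0.
- by apply: ler_pM => //; exact: sqr_ge0.
Qed.

Let v_ge_vout z : vout z <= v z.
Proof. by rewrite /v; case: ifP => // _; rewrite le_max lexx orbT. Qed.

Let v_ge_vin z : G z -> vin z <= v z.
Proof. by rewrite /v => ->; rewrite le_max lexx. Qed.

Let v_eq_vout z : D z -> d <= normc (h z) -> eps / 2 <= enorm (z - q) -> v z = vout z.
Proof.
by move=> Dz dh ez; rewrite /v; case: ifP => // Gz; rewrite max_r ?vin_le_vout.
Qed.

Let v_lt1 z : D z -> 0 <= v z < 1.
Proof.
move=> Dz; rewrite (le_trans (vout_ge0 z) (v_ge_vout z))/=.
have o1 : vout z < 1.
  have zM : enorm (z - q) ^+ 2 <= M ^+ 2.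
    by rewrite lerXn2r ?nnegrE ?enorm_ge0 ?DM// ltW.
  have pe : `|normc (h z) / d| `^ k <= expR 1.
    have -> : expR 1 = (M / d) `^ k.
      rewrite /powR gt_eqF ?(lt_trans _ Md)// /k mulVf// gt_eqF// ln_gt0//.
    apply: le_powR => //; first exact: ltW.
    rewrite ger0_norm ?ratio_ge0// ler_pM2r ?invr_gt0//.
    exact: le_trans (normch_le z) (DM Dz).
  rewrite /vout mulrAC ltr_pdivrMr// mul1r /K.
  apply: (@le_lt_trans _ _ (4 * T * (expR 1 * M ^+ 2))); last by rewrite mulrA ltrDl.
  apply: ler_wpM2l; first by apply: mulr_ge0 => //; exact: ltW.
  by apply: ler_pM; [exact: powR_ge0|exact: sqr_ge0| |].
rewrite /v; case: ifP => // Gz; rewrite gt_max o1 andbT.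
apply: le_lt_trans (vin_le Dz Gz) _; rewrite ltr_pdivrMr// mul1r /K.
apply: (@le_lt_trans _ _ T); last by rewrite ltrDr.
by rewrite ler_piMl ?(ltW T0)// expr_le1// ltW.
Qed.

Let cont_h z : {for z, continuous (fun y => normc (h y))}.
Proof.
have -> : (fun y => normc (h y)) = fun y => normc (hdot (y - q) nu - 0).
  by apply/funext => y; rewrite subr0.
exact: continuous_normc_hdot.
Qed.

Let cont_enorm z : {for z, continuous (fun y : Cn => enorm (y - q))}.
Proof. exact: continuous_enormB. Qed.

Let cont_vout z : {for z, continuous vout}.
Proof.
have c1 : {for z, continuous (fun y => normc (h y) / d)}.
  exact: (continuousM (cont_h z) (@cst_continuous _ _ d^-1 z)).
have c2 : {for z, continuous (fun y => `|normc (h y) / d| `^ k)}.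
  exact: (continuous_comp c1 (continuous_norm_powR k k0 _)).
have c3 := continuousM (cont_enorm z) (cont_enorm z).
exact: (continuousM (@cst_continuous _ _ (4 * T / K) z) (continuousM c2 c3)).
Qed.

Let cont_dd z : {for z, continuous dd}.
Proof.
have c : {for z, continuous (fun y => normc (h y - (3 * d)%:C))}.
  exact: continuous_normc_hdot.
exact: (continuousM c c).
Qed.

Let cont_vin z : D z -> G z -> {for z, continuous vin}.
Proof.
move=> Dz Gz; have dz : dd z != 0 by rewrite gt_eqF// dd_gt0.
have c1 := continuousV dz (cont_dd z).
have c2 : {for z, continuous (fun y : Cn => enorm (L (y - q)))}.
  exact: (continuous_enormL L (d + 1) q linL LK).
exact: (continuousM (continuousM c2 c2)
  (continuousM (@cst_continuous _ _ (eps ^+ 2 / K) z) c1)).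
Qed.

Let near_D z : D z -> \forall y \near z, D y.
Proof. by move=> Dz; exact: open_nbhs_nbhs. Qed.

Let near_G z : G z -> \forall y \near z, G y.
Proof.
case/orP => [hz|hz].
  have := continuous_lt_near _ _ _ (cont_h z) (@cst_continuous _ _ (3 / 2 * d) z) hz.
  by apply: filterS => y hy; rewrite /G hy.
have := continuous_lt_near _ _ _ (cont_enorm z) (@cst_continuous _ _ eps z) hz.
by apply: filterS => y hy; rewrite /G hy orbT.
Qed.

Let near_vout z : D z -> ~~ G z -> \forall y \near z, v y = vout y.
Proof.
move=> Dz; rewrite negb_or -!leNgt => /andP[hz zq].
have h1 : d < normc (h z) by apply: lt_le_trans hz; move: d0; lra.
have h2 : eps / 2 < enorm (z - q) by apply: lt_le_trans zq; move: e0; lra.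
have n1 := continuous_lt_near _ _ _ (@cst_continuous _ _ d z) (cont_h z) h1.
have n2 := continuous_lt_near _ _ _ (@cst_continuous _ _ (eps / 2) z) (cont_enorm z) h2.
apply: filterS2 (near_D Dz) (filterI n1 n2) => y Dy [/ltW a /ltW b].
exact: v_eq_vout.
Qed.

Let cont_ext (f g : Cn -> R) z : (\forall y \near z, f y = g y) ->
  {for z, continuous g} -> {for z, continuous f}.
Proof.
move=> fg cg; rewrite /prop_for /continuous_at (nbhs_singleton fg).
have gf : \forall y \near z, g y = f y by apply: filterS fg => y ->.
exact: cvg_trans (near_eq_cvg gf) cg.
Qed.

Let cont_v z : D z -> {for z, continuous v}.
Proof.
move=> Dz; have [Gz|Gz] := boolP (G z).
  have E : \forall y \near z, v y = Num.max (vin y) (vout y).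
    by apply: filterS (near_G z Gz) => y Gy; rewrite /v Gy.
  have C : {for z, continuous (fun y => Num.max (vin y) (vout y))}.
    exact: (continuous_max (cont_vin Dz Gz) (cont_vout z)).
  exact: (@cont_ext v _ z E C).
exact: (@cont_ext v vout z (near_vout Dz Gz) (cont_vout z)).
Qed.

Let h_shift z w x : h (z + x *: w) = h z + hdot w nu * x.
Proof. by rewrite /h addrAC (hdotDl (z - q)) hdotZl mulrC. Qed.

Let lsm_vout z w : 0 < vout z -> locally_submean (fun x => ln (vout (z + x *: w))) 0.
Proof.
move=> vz.
have pos y : 0 < vout y -> h y != 0 /\ y - q != 0.
  move=> vy; split; apply: contraTneq vy => E; rewrite /vout E.
    by rewrite Normc.normc0 mul0r normr0 powR0 ?gt_eqF// mul0r mulr0 ltxx.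
  by rewrite enorm0 expr0n !mulr0 ltxx.
have lnv y : 0 < vout y -> ln (vout y) = ln (enorm (y - q) ^+ 2) +
    (k / 2 * ln (normc (h y) ^+ 2) + (ln (4 * T / K) - k * ln d)).
  move=> /pos[hy yq]; have hp : 0 < normc (h y) by rewrite normc_gt0.
  have yp : 0 < enorm (y - q) ^+ 2 by rewrite exprn_gt0// enorm_gt0.
  have rp : 0 < normc (h y) / d by rewrite divr_gt0.
  have ap : 0 < `|normc (h y) / d| `^ k by rewrite powR_gt0// normr_gt0 gt_eqF.
  have lnM2 (a b : R) : 0 < a -> 0 < b -> ln (a * b) = ln a + ln b.
    by move=> a0 b0; apply: lnM; rewrite posrE.
  rewrite /vout (lnM2 _ _ TK0 (mulr_gt0 ap yp)) (lnM2 _ _ ap yp) ln_powR gtr0_norm//.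
  have -> : ln (normc (h y) / d) = ln (normc (h y)) - ln d.
    by apply: ln_div; rewrite posrE.
  rewrite (lnXn 2 hp) -(mulr_natl (ln (normc (h y)))).
  by field.
apply: (locally_submean_support _ (fun x => ln (enorm (z - q + x *: w) ^+ 2) +
    (k / 2 * ln (normc (h z + hdot w nu * x) ^+ 2) + (ln (4 * T / K) - k * ln d)))).
- by rewrite scale0r !addr0 mulr0 addr0 lnv.
- have [r r0 hr] := near_complex_line _ z w (continuous_gt0_near _ _ (cont_vout z) vz).
  by exists r => // x /hr px; rewrite lnv// h_shift [z + _ - q]addrAC.
have [hz zq] := pos _ vz.
apply: locally_submeanD; first exact: locally_submean_ln_enorm.
apply: locally_submeanD; last exact: locally_submean_cst.
apply: locally_submeanZ; first by rewrite divr_ge0 ?ltW.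
exact: locally_submean_ln_normc.
Qed.

Let lsm_vin z w : D z -> G z -> 0 < vin z ->
  locally_submean (fun x => ln (vin (z + x *: w))) 0.
Proof.
move=> Dz Gz vz.
have pos y : 0 < vin y -> L (y - q) != 0 /\ h y - (3 * d)%:C != 0.
  move=> vy; split; apply: contraTneq vy => E; rewrite /vin /W.
    by rewrite /N E enorm0 expr0n mul0r ltxx.
  by rewrite /dd E Normc.normc0 expr0n invr0 !mulr0 ltxx.
have lnv y : 0 < vin y -> ln (vin y) = ln (enorm (L (y - q)) ^+ 2) +
    (- ln (normc (h y - (3 * d)%:C) ^+ 2) + ln (eps ^+ 2 / K)).
  move=> /pos[Ly hy]; have Np : 0 < N y by rewrite exprn_gt0// enorm_gt0.
  have dp : 0 < dd y by rewrite exprn_gt0// normc_gt0.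
  have lnM2 (a b : R) : 0 < a -> 0 < b -> ln (a * b) = ln a + ln b.
    by move=> a0 b0; apply: lnM; rewrite posrE.
  have dp' : 0 < (dd y)^-1 by rewrite invr_gt0.
  rewrite /vin /W (lnM2 _ _ Np (mulr_gt0 eK0 dp')) (lnM2 _ _ eK0 dp').
  by rewrite lnV ?posrE// (addrC (ln (eps ^+ 2 / K))).
have LE x : L (z + x *: w - q) = L (z - q) + x *: L w.
  by rewrite addrAC addrC linL addrC.
have hE x : h (z + x *: w) - (3 * d)%:C = (h z - (3 * d)%:C) + hdot w nu * x.
  by rewrite h_shift addrAC.
apply: (locally_submean_support _ (fun x => ln (enorm (L (z - q) + x *: L w) ^+ 2) +
    (- ln (normc ((h z - (3 * d)%:C) + hdot w nu * x) ^+ 2) + ln (eps ^+ 2 / K)))).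
- by rewrite !scale0r mulr0 !addr0 lnv.
- have [r r0 hr] := near_complex_line _ z w
    (continuous_gt0_near _ _ (cont_vin Dz Gz) vz).
  by exists r => // x /hr px; rewrite lnv// LE hE.
have [Lz hz] := pos _ vz.
apply: locally_submeanD; first exact: locally_submean_ln_enorm.
apply: locally_submeanD; last exact: locally_submean_cst.
exact: locally_submean_Nln_normc.
Qed.

(** The branch attaining [v z] supports [v] from below: [vout] everywhere, [vin] on the open set
    [G]. *)
Let lsm_v z w : D z -> 0 < v z -> locally_submean (fun x => ln (v (z + x *: w))) 0.
Proof.
move=> Dz vz.
have [E|[Gz E]] : v z = vout z \/ G z /\ v z = vin z.
  rewrite /v; case: ifP => Gz; last by left.
  by have [_|_] := leP (vin z) (vout z); [left|right].
- rewrite E in vz.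
  apply: (locally_submean_support _ (fun x => ln (vout (z + x *: w)))).
  + by rewrite scale0r addr0 E.
  + have [r r0 hr] := near_complex_line _ z w (continuous_gt0_near _ _ (cont_vout z) vz).
    exists r => // x /hr px; have pv := lt_le_trans px (v_ge_vout _).
    by rewrite ler_ln ?posrE.
  exact: lsm_vout.
- rewrite E in vz.
  apply: (locally_submean_support _ (fun x => ln (vin (z + x *: w)))).
  + by rewrite scale0r addr0 E.
  + have [r r0 hr] := near_complex_line _ z w
      (filterI (continuous_gt0_near _ _ (cont_vin Dz Gz) vz) (near_G z Gz)).
    exists r => // x /hr[px Gx]; have pv := lt_le_trans px (v_ge_vin _ Gx).
    by rewrite ler_ln ?posrE// v_ge_vin.
  exact: lsm_vin.
Qed.

Let hq : h q = 0. Proof. by rewrite /h subrr hdot0l. Qed.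

Let v_near_q : \forall y \near q, v y = N y * W y.
Proof.
(* Near [q], [N] is at least [d ^+ 2 * enorm (y - q) ^+ 2] and [dd] at most [25 * d ^+ 2], so
   [vout <= vin] once the power of [normc (h y) / d] is at most [b]. Inverting the power gives
   [r]. *)
pose b := eps ^+ 2 / (100 * T); have b0 : 0 < b.
  by rewrite divr_gt0 ?exprn_gt0 ?mulr_gt0.
pose r := d * Num.min 1 (b `^ k^-1).
have r0 : 0 < r by rewrite mulr_gt0// lt_min ltr01 powR_gt0.
apply/nbhs_enormP; exists r => // y yr.
have yd : enorm (y - q) < d.
  by apply: lt_le_trans yr _; rewrite ler_piMr ?ge_min ?lexx ?(ltW d0).
have hd : normc (h y) < d := le_lt_trans (normch_le y) yd.
have Gy : G y by rewrite /G; apply/orP; left; apply: lt_trans hd _; move: d0; lra.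
rewrite /v Gy max_l//.
have dpos : 0 < dd y.
  rewrite exprn_gt0// normc_gt0; apply: contraTneq hd => /eqP.
  rewrite subr_eq0 => /eqP ->; rewrite normc_real gtr0_norm ?mulr_gt0//.
  by rewrite -leNgt; move: d0; lra.
have dd25 : dd y <= 25 * d ^+ 2.
  have -> : 25 * d ^+ 2 = (5 * d) ^+ 2 by ring.
  rewrite lerXn2r ?nnegrE ?normc_ge0 ?mulr_ge0 ?(ltW d0)//.
  apply: le_trans (le_normcD _ _) _.
  rewrite normcN normc_real gtr0_norm ?mulr_gt0//.
  by move: hd d0; lra.
have pb : `|normc (h y) / d| `^ k <= b.
  have -> : b = (b `^ k^-1) `^ k by rewrite -powRrM mulVf ?gt_eqF// powRr1// ltW.
  apply: le_powR => //; first exact: ltW.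
  rewrite ger0_norm ?ratio_ge0// ler_pdivrMr//.
  apply: le_trans (ltW (le_lt_trans (normch_le y) yr)) _.
  by rewrite /r mulrC ler_pM2r// ge_min lexx orbT.
have N25 : d ^+ 2 * enorm (y - q) ^+ 2 <= N y.
  rewrite /N NE lerDl mulr_ge0 ?sqr_ge0//.
  by move: d0; lra.
rewrite /vout /vin /W.
apply: (@le_trans _ _ (4 * T / K * (b * enorm (y - q) ^+ 2))).
  rewrite ler_wpM2l ?divr_ge0 ?mulr_ge0 ?(ltW K0) ?(ltW T0)//.
  by rewrite ler_wpM2r ?sqr_ge0.
have -> : 4 * T / K * (b * enorm (y - q) ^+ 2) =
    eps ^+ 2 / K * (d ^+ 2 * enorm (y - q) ^+ 2 / (25 * d ^+ 2)).
  by rewrite /b; field; rewrite !gt_eqF.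
rewrite [leRHS]mulrCA ler_wpM2l ?divr_ge0 ?sqr_ge0 ?(ltW K0)//.
apply: ler_pM => //.
- by rewrite mulr_ge0 ?sqr_ge0.
- by rewrite invr_ge0 mulr_ge0 ?sqr_ge0.
- by rewrite lef_pV2 ?posrE// mulr_gt0// exprn_gt0.
Qed.

Let CW : Ck_near 2 W q.
Proof.
have ddE y : dd y = normc (hdot y nu - (hdot q nu + (3 * d)%:C)) ^+ 2.
  by rewrite /dd /h hdotBl opprD addrA.
have ddq : dd q != 0.
  by rewrite gt_eqF// exprn_gt0// hq sub0r normcN normc_real normr_gt0 gt_eqF ?mulr_gt0.
apply: Ck_nearM; first exact: Ck_near_cst.
apply: Ck_nearV => //.
apply: Ck_near_ext (Ck_near_normc_hdot 2 nu (hdot q nu + (3 * d)%:C) q).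
by apply: near_all => y; rewrite -ddE.
Qed.

Lemma Sibony_barrier X :
  ((eps / (3 * d * Num.sqrt (4 * (4 * M ^+ 2 + 147) * expR 1 * M ^+ 2
      + (4 * M ^+ 2 + 147))) * normc (hdot X nu))%:E <= Sibony D q X)%E.
Proof.
have [Cv Lv] := Levi_quadratic L (d + 1) q linL LK W CW v X v_near_q.
pose s := eps / (3 * d * Num.sqrt K) * enorm (L X).
have sK : 0 < Num.sqrt K by rewrite sqrtr_gt0.
have s0 : 0 <= s.
  by rewrite mulr_ge0 ?enorm_ge0// divr_ge0 ?(ltW e0)// !mulr_ge0// ltW.
apply: (@le_trans _ _ s%:E).
  have a0 : 0 <= eps / (3 * d * Num.sqrt K).
    apply: divr_ge0; first exact: ltW.
    by apply: mulr_ge0; [apply: mulr_ge0 => //|]; exact: ltW.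
  apply: (ler_wpM2l a0).
  rewrite -(@ler_pXn2r _ 2)// ?nnegrE ?normc_ge0 ?enorm_ge0// NE.
  have a1 := sqr_ge0 (normc (hdot X nu)).
  have a2 : 0 <= d ^+ 2 * enorm X ^+ 2 by rewrite mulr_ge0 ?sqr_ge0.
  have a3 := mulr_ge0 (ltW d0) a1.
  by move: a1 a2 a3; lra.
apply: (Sibony_ge _ _ _ v) => //.
- split=> //.
  + rewrite (nbhs_singleton v_near_q) /N subrr.
    have -> : L 0 = 0 by rewrite /L scaler0 hdot0l scale0r addr0.
    by rewrite enorm0 expr0n mul0r.
  + exact: plurisubharmonic_lne.
rewrite Lv; congr (_%:C); rewrite /W /dd hq sub0r normcN normc_real.
have E : (eps / (3 * d * Num.sqrt K)) ^+ 2 = eps ^+ 2 / ((3 * d) ^+ 2 * K).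
  by rewrite expr_div_n [(_ * Num.sqrt K) ^+ 2]exprMn sqr_sqrtr// ltW.
rewrite (gtr0_norm (x := 3 * d)) ?mulr_gt0// /s [RHS]exprMn E.
by field; rewrite !gt_eqF.
Qed.

End Barrier.

Unset Implicit Arguments.

Section BoundedDomain.
Context {R : realType} {n : nat}.
Local Notation Cn := 'rV[R[i]]_n.

Lemma bounded_enorm (D : set Cn) : bounded_set D ->
  exists2 M : R, 1 <= M & forall z w, D z -> D w -> enorm (z - w) <= M.
Proof.
move=> [[a b] [ab hD]].
have b0 : b = 0 by move: ab; rewrite complex_real => /eqP.
have B z j : D z -> normc (z 0 j) <= `|a| + 1.
  move=> Dz; have := hD ((`|a| + 1)%:C) _ z Dz.
  rewrite b0 ltcE /= eqxx /= => /(_ (le_lt_trans (ler_norm a) _)) h.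
  rewrite -lecR -normr_normc; apply: le_trans (h _); last by rewrite ltrDl.
  rewrite /Num.norm /= mx_normE.
  exact: (le_bigmax _ (fun i : 'I_1 * 'I_n => `|z i.1 i.2|%:nng) (0, j)).
pose S := \sum_(j < n) (`|a| + 1).
have S0 : 0 <= S by apply: sumr_ge0 => j _; rewrite addr_ge0.
have DS z : D z -> enorm z <= S.
  by move=> Dz; apply: le_trans (enorm_le_sum _) _; apply: ler_sum => j _; exact: B.
exists (2 * S + 1); first by lra.
move=> z w Dz Dw; apply: le_trans (enormD _ _) _; rewrite enormN.
by have := DS _ Dz; have := DS _ Dw; lra.
Qed.

Lemma line_proj_norm (q pq X : Cn) : pq != q ->
  enorm (line_proj q pq X) = normc (hdot X (unit_normal q pq)).
Proof.
move=> pqq; have [nu1 E] := unit_normalE q pq pqq.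
have d0 : 0 < enorm (pq - q) by rewrite enorm_gt0 subr_eq0.
rewrite /line_proj enormZ hdotxx /unit_normal hdotZr conjC_realc !Normc.normcM.
rewrite Normc.normcV !normc_real !ger0_norm ?sqr_ge0 ?invr_ge0 ?enorm_ge0//.
by field; rewrite gt_eqF.
Qed.

End BoundedDomain.

(** * Uniform constants and conclusion *)

Local Open Scope complex_scope.

Theorem proposition7 (R : realType) (n : nat) (D : set 'rV[R[i]]_n)
    (p : 'rV[R[i]]_n) (hD : bounded_domain D) (hp : boundary D p)
    (hC1 : C1_boundary_near D p) :
  exists (c : R) (U : set 'rV[R[i]]_n), [/\ 0 < c, nbhs p U &
    forall q pq X : 'rV[R[i]]_n, D q -> U q ->
      boundary D pq -> enorm (q - pq) = delta D q ->
      ((delta_star D q pq / delta D q * enorm (line_proj q pq X)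
        + enorm X)%:E <= c%:E * Sibony D q X)%E].
Proof.
case: hD => oD _ _ /bounded_enorm[M M1 DM].
have M0 : 0 < M by apply: lt_le_trans M1.
have [r r0 sector] := domain_below_cone D p oD hp hC1.
pose T := 4 * M ^+ 2 + 147.
pose K := 4 * T * expR 1 * M ^+ 2 + T.
(* The bound [r] gives access to the sector estimate, and [2^-1] ensures [delta D q < 1]. *)
pose s := Num.min r 2^-1.
have s0 : 0 < s by rewrite lt_min r0 invr_gt0 ltr0n.
have sr : s <= r by rewrite ge_min lexx.
have s1 : s <= 2^-1 by rewrite ge_min lexx orbT.
have K0 : 0 < K.
  have T0 : 0 < T by rewrite /T; have := sqr_ge0 M; lra.
  apply: addr_gt0 => //; apply: mulr_gt0; last exact: exprn_gt0.
  by apply: mulr_gt0; [apply: mulr_gt0|exact: expR_gt0].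
have sK : 0 < Num.sqrt K by rewrite sqrtr_gt0.
pose a := s / (3 * Num.sqrt K).
have a0 : 0 < a by apply: divr_gt0 => //; apply: mulr_gt0.
have M10 : 0 < M + 1 by lra.
exists (a^-1 + (M + 1)), [set q | enorm (q - p) < s]; split.
- by rewrite addr_gt0 ?invr_gt0.
- by apply/nbhs_enormP; exists s.
move=> q pq X Dq /= qp Dpq qpq.
have pqq : pq != q.
  by apply: contra_notN (open_boundary_notin _ _ oD Dpq) => /eqP->.
have d0 : 0 < delta D q by rewrite -qpq enorm_gt0 subr_eq0 eq_sym.
have d1 : delta D q < 1.
  apply: le_lt_trans (delta_le D q p hp) _; apply: lt_le_trans qp _; lra.
have [nu1 _] := unit_normalE q pq pqq.
have /andP[ds0 ds1] := delta_star_ge0_le1 D q pq.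
have SX : (((M + 1)^-1 * enorm X)%:E <= Sibony D q X)%E.
  apply: Sibony_norm => // z Dz; apply: le_lt_trans (DM _ _ Dz Dq) _; lra.
have Sn : ((a * (delta_star D q pq / delta D q * enorm (line_proj q pq X)))%:E
    <= Sibony D q X)%E.
  rewrite (line_proj_norm _ _ _ pqq).
  (* The barrier needs [0 < eps]; if [delta_star] is 0, the normal term vanishes. *)
  move: ds0; rewrite le_eqVlt => /predU1P[<-|dsp].
    rewrite mul0r mul0r mulr0; apply: le_trans SX; rewrite lee_fin.
    by rewrite mulr_ge0 ?invr_ge0 ?enorm_ge0// ltW.
  (* A fixed multiple of [delta_star] that is also at most [r] and 1; the ratio [s] enters the
     constant [a], which therefore does not depend on [q]. *)
  pose eps := s * delta_star D q pq.
  have e0 : 0 < eps by rewrite mulr_gt0.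
  have es : eps <= s by rewrite ler_piMr// ltW.
  have eds : eps <= delta_star D q pq by rewrite ler_piMl//; lra.
  have e1 : eps <= 1 by lra.
  have sec z : D z -> enorm (z - q) < eps ->
      Re (hdot (z - q) (unit_normal q pq)) - 2 * delta D q
        < `|Im (hdot (z - q) (unit_normal q pq))|.
    move=> Dz ze; apply: sector => //; first exact: lt_le_trans sr.
      by apply: lt_le_trans ze _; exact: le_trans sr.
    exact: lt_le_trans eds.
  have H := @Sibony_barrier R n D q (unit_normal q pq) (delta D q) eps M
    oD nu1 d0 d1 e0 e1 M1 (fun z Dz => DM _ _ Dz Dq) sec X.
  apply: le_trans H; rewrite lee_fin -/T -/K /a /eps le_eqVlt.
  by apply/orP; left; apply/eqP; field; rewrite !gt_eqF.
have b0 : 0 < (M + 1)^-1 by rewrite invr_gt0.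
move: Sn SX; set A := delta_star D q pq / _ * _; set B := enorm X => Sn SX.
have A1 : (A%:E <= (a^-1)%:E * Sibony D q X)%E.
  by rewrite -lee_pdivrMl ?invr_gt0// invrK -EFinM.
have B1 : (B%:E <= (M + 1)%:E * Sibony D q X)%E.
  by rewrite -lee_pdivrMl// -EFinM.
have S0 : (0 <= Sibony D q X)%E.
  by apply: le_trans SX; rewrite lee_fin mulr_ge0 ?enorm_ge0// ltW.
rewrite EFinD; apply: le_trans (leeD A1 B1) _.
have ia : (0 <= (a^-1)%:E)%E by rewrite lee_fin invr_ge0 ltW.
have im : (0 <= (M + 1)%:E)%E by rewrite lee_fin ltW.
by rewrite [(a^-1 + _)%:E]EFinD (ge0_muleDl _ ia im).
Qed.
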